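(* Let $\mu\in\mathbb{C}$, $b\in\mathbb{C}\setminus\{0,-1,-2,\ldots\}$, $\gamma\in\mathbb{C}\setminus\{0\}$, $0\le\lambda<1$. Let $\phi(z)=1+B_1z+B_2z^2+\cdots$ be analytic in the open unit disk $\triangle$ with $B_1>0$, and let $\psi(z)=C_0+C_1z+C_2z^2+\cdots$ be analytic in $\triangle$ with $|\psi(z)|<1$. If $f(z)=z+\sum_{n\ge 2}a_nz^n$ belongs to the class $\mathcal{G}^{\mu,b}_{\Sigma}(\gamma,\lambda,\phi)$ (with quasi-subordination multiplier $\psi$), then $$|a_2|\le\frac{|\gamma|\,|C_0|\,B_1\sqrt{B_1}}{\sqrt{\left|\left[\gamma C_0(\lambda^2-1)B_1^2+(1-\lambda)^2(B_1-B_2)\right]\Theta_2^2+2\gamma(1-\lambda)C_0B_1^2\Theta_3\right|}}$$ and $$|a_3|\le\frac{|\gamma||C_1|B_1}{2(1-\lambda)\Theta_3}+\frac{|\gamma||C_0|B_1}{2(1-\lambda)\Theta_3}+\frac{|\gamma|^2|C_0|^2B_1^2}{(1-\lambda)^2\Theta_2^2}.$$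
   Context: $\triangle=\{z\in\mathbb{C}:|z|<1\}$. $\mathcal{A}$ is the class of functions $f(z)=z+\sum_{n\ge2}a_nz^n$ analytic in $\triangle$. A function $f\in\mathcal{A}$ is bi-univalent if $f$ is univalent in $\triangle$ and its inverse $f^{-1}$ (defined near $0$, on a disk of radius at least $1/4$) extends to a univalent function in $\triangle$; $\Sigma$ is the class of bi-univalent functions. For $f\in\Sigma$, $g=f^{-1}$ (as extended to $\triangle$), so $g(w)=w-a_2w^2+(2a_2^2-a_3)w^3-\cdots$. The (Srivastava–Attiya type) operator $\mathcal{J}_\mu^b:\mathcal{A}\to\mathcal{A}$ is $\mathcal{J}_\mu^bf(z)=z+\sum_{k\ge2}\Theta_ka_kz^k$, where $\Theta_k=\left|\left(\frac{1+b}{k+b}\right)^{\mu}\right|$ (principal power). Quasi-subordination: with the fixed analytic function $\psi(z)=C_0+C_1z+C_2z^2+\cdots$, $|\psi(z)|<1$ in $\triangle$, $F\prec_{\widetilde q}h$ means that there is an analytic $u$ in $\triangle$ with $u(0)=0$, $|u(z)|<1$, such that $F(z)=\psi(z)\,h(u(z))$ for all $z\in\triangle$. The same multiplier $\psi$ is used in both conditions below (the functions $u$ may differ). Class $\mathcal{G}^{\mu,b}_{\Sigma}(\gamma,\lambda,\phi)$: all $f\in\Sigma$ such that, with $g=f^{-1}$, $$\frac1\gamma\left(\frac{z(\mathcal{J}_\mu^bf(z))'}{(1-\lambda)\mathcal{J}_\mu^bf(z)+\lambda z(\mathcal{J}_\mu^bf(z))'}-1\right)\prec_{\widetilde q}\phi(z)-1,$$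 $$\frac1\gamma\left(\frac{w(\mathcal{J}_\mu^bg(w))'}{(1-\lambda)\mathcal{J}_\mu^bg(w)+\lambda w(\mathcal{J}_\mu^bg(w))'}-1\right)\prec_{\widetilde q}\phi(w)-1\qquad(z,w\in\triangle),$$ the quotients taking the value $1$ at the origin. *)

(* Defs.v *)
(* Standard-library reals with Coquelicot's complex numbers. *)
From Stdlib Require Import Reals.
From Coquelicot Require Import Coquelicot.

Open Scope C_scope.

(* Functions on the unit disk are total functions C -> C of which only the
   values at points z with Cmod z < 1 are ever constrained. *)
Definition in_disk (z : C) : Prop := (Cmod z < 1)%R.

Definition is_Cpseries (a : nat -> C) (z l : C) : Prop :=
  @is_pseries C_AbsRing C_NormedModule a z l.

Definition analytic_disk (f : C -> C) : Prop :=
  forall z0 : C, in_disk z0 ->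
    exists c : nat -> C,
      locally z0 (fun z : C => is_Cpseries c (z - z0) (f z)).

(* f(z) = a_0 + a_1 z + a_2 z^2 + ... throughout the disk *)
Definition has_expansion (f : C -> C) (a : nat -> C) : Prop :=
  forall z : C, in_disk z -> is_Cpseries a z (f z).

(* The class A, together with the Taylor coefficients at the origin. *)
Definition classA (f : C -> C) (a : nat -> C) : Prop :=
  analytic_disk f /\ has_expansion f a /\ a 0%nat = 0 /\ a 1%nat = 1.

Definition univalent (f : C -> C) : Prop :=
  analytic_disk f /\
  forall z1 z2 : C, in_disk z1 -> in_disk z2 -> f z1 = f z2 -> z1 = z2.

(* g is a univalent function on the disk extending the inverse of f, which is
   a priori defined near 0 only; by the identity theorem there is at most one
   such g, up to its values outside the disk. *)
Definition extended_inverse (f g : C -> C) : Prop :=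
  univalent g /\
  locally (0 : C) (fun w : C => in_disk (g w) /\ f (g w) = w).

Definition classSigma (f : C -> C) : Prop :=
  (exists a : nat -> C, classA f a) /\ univalent f /\
  exists g : C -> C, extended_inverse f g.

(* Principal argument, in ]-PI, PI] (meaningful for z <> 0). *)
Definition Carg (z : C) : R :=
  if Rle_dec 0 (Im z) then acos (Re z / Cmod z) else (- acos (Re z / Cmod z))%R.

Definition Cexp (z : C) : C :=
  ((exp (Re z) * cos (Im z))%R, (exp (Re z) * sin (Im z))%R).

Definition Clog (z : C) : C := (ln (Cmod z), Carg z).

(* Principal power z ^ mu (meaningful for z <> 0). *)
Definition Cpower (z mu : C) : C := Cexp (mu * Clog z).

Definition Theta (mu b : C) (k : nat) : R :=
  Cmod (Cpower ((1 + b) / (INR k + b)) mu).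

Definition CSeries (a : nat -> C) : C :=
  (Series (fun n : nat => Re (a n)), Series (fun n : nat => Im (a n))).

(* The operator J_mu^b applied to the function z + a_2 z^2 + a_3 z^3 + ... *)
Definition SA_operator (mu b : C) (a : nat -> C) (z : C) : C :=
  z + CSeries (fun n : nat => Theta mu b (n + 2) * a (n + 2)%nat * z ^ (n + 2)).

Definition quasi_subordinate (psi F h : C -> C) : Prop :=
  exists u : C -> C,
    analytic_disk u /\ u 0 = 0 /\
    (forall z : C, in_disk z -> in_disk (u z)) /\
    (forall z : C, in_disk z -> F z = psi z * h (u z)).

Definition G_denominator (lambda : R) (J : C -> C) (z : C) : C :=
  (1 - lambda) * J z + lambda * (z * C_derive J z).

Definition G_expression (gamma : C) (lambda : R) (J : C -> C) (z : C) : C :=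
  / gamma *
  ((if Ceq_dec z 0 then 1 else z * C_derive J z / G_denominator lambda J z) - 1).

(* The quotient has to be defined at every nonzero point of the disk; this is
   required explicitly because Coquelicot's division is total. *)
Definition G_condition (mu b gamma : C) (lambda : R) (phi psi : C -> C)
    (a : nat -> C) : Prop :=
  let J := SA_operator mu b a in
  (forall z : C, in_disk z -> z <> 0 -> G_denominator lambda J z <> 0) /\
  quasi_subordinate psi (G_expression gamma lambda J) (fun z : C => phi z - 1).

Definition classG (mu b gamma : C) (lambda : R) (phi psi f : C -> C) : Prop :=
  classSigma f /\
  exists (g : C -> C) (a c : nat -> C),
    extended_inverse f g /\ classA f a /\ classA g c /\
    G_condition mu b gamma lambda phi psi a /\
    G_condition mu b gamma lambda phi psi c.

(* Main.v *)
Require Import Defs.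
From Stdlib Require Import Reals Lra Lia List Classical ClassicalEpsilon.
From Coquelicot Require Import Coquelicot.

Open Scope C_scope.

(** Comparing second-order expansions at the origin in the two subordination
    conditions expresses [a 2] and [a 3] through the Taylor coefficients
    [u1, u2] and [v1, v2] of the two Schwarz functions.  If [C0 <> 0] then
    [v1 = - u1], and eliminating [a 3] gives
    [2 D a2^2 = gamma^2 C0^2 B1^3 (u2 + v2 + 2 u1^2)], so both bounds follow
    from [|u1| <= 1] and [|u2| <= 1 - |u1|^2]; if [C0 = 0] then [a 2 = 0].

    The Schwarz-Pick inequality for [u1, u2] is obtained without Cauchy's
    integral formula: the maximum principle only needs a second-order
    expansion at every point, because [|F|^2 + e |z|^2] has a positive
    Laplacian. *)

(** * Second-order expansions *)

(** Second-order expansions reach [a 3] because every identity is first divided by [z]. With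
    [J = z K] the defining condition becomes [J' = (1 + gamma psi (phi(u) - 1)) ((1 - lambda) K +
    lambda J')], where [K] and [J'] carry the coefficients of index 1 to 3 at orders 0 to 2.

    The term [B1 - B2] in [D] comes from trading [B2 u1^2] for [B1 u1^2]: the first-order equation
    makes [u1^2] a multiple of [a2^2], so [B1 (u2 + v2) + 2 B2 u1^2] can be completed to
    [B1 (u2 + v2 + 2 u1^2)]. The last factor has modulus at most [2 (1 - |u1|^2) + 2 |u1|^2 = 2];
    with only [|u2| <= 1] and [|v2| <= 1] the constant would be lost.

    Analyticity supplies a power series around each point and nothing global, so the passage from
    local data to a bound on the whole disk rests on compactness. *)

Lemma locally_Cmod (z : C) (P : C -> Prop) :
  locally z P <->
  exists d : R, (0 < d)%R /\ forall h : C, (Cmod h < d)%R -> P (z + h).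
Proof.
  split.
  - intros [d Hd]; exists d; split; [apply cond_pos|].
    intros h Hh; apply Hd, C_NormedModule_mixin_compat1.
    unfold minus, plus, opp; simpl.
    now replace (z + h + - z) with h by ring.
  - intros [d [Hd HP]].
    (* Balls of the uniform structure on [C] are squares; one of half-side [d / sqrt 2] fits inside
       the disk of radius [d]. *)
    assert (Hs : (0 < sqrt 2)%R) by (apply sqrt_lt_R0; lra).
    assert (He : (0 < d / sqrt 2)%R) by now apply Rdiv_lt_0_compat.
    exists (mkposreal _ He); intros y Hy.
    apply C_NormedModule_mixin_compat2 in Hy; simpl in Hy.
    replace y with (z + (y - z)) by ring.
    apply HP.
    replace d with (sqrt 2 * (d / sqrt 2))%R by (field; lra).
    exact Hy.
Qed.

(** The bound is also required at [h = 0], so a positive exponent forces [F 0 = 0]; this is how a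
    jet pins down the value at its centre. *)
Definition bigO (n : nat) (F : C -> C) : Prop :=
  exists K : R, locally (0 : C) (fun h : C => (Cmod (F h) <= K * Cmod h ^ n)%R).

Lemma locally_0_lt (d : R) (hd : (0 < d)%R) :
  locally (0 : C) (fun h : C => (Cmod h < d)%R).
Proof.
  apply locally_Cmod; exists d; split; trivial.
  intros h; now rewrite Cplus_0_l.
Qed.

Lemma bigO_ext (n : nat) (F G : C -> C) :
  locally (0 : C) (fun h : C => F h = G h) -> bigO n F -> bigO n G.
Proof.
  intros H [K HK]; exists K.
  generalize (filter_and _ _ H HK); apply filter_imp.
  now intros h [<- ?].
Qed.

Lemma bigO_nonneg (n : nat) (F : C -> C) :
  bigO n F -> exists K : R, (0 <= K)%R /\
    locally (0 : C) (fun h : C => (Cmod (F h) <= K * Cmod h ^ n)%R).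
Proof.
  intros [K HK]; exists (Rabs K); split; [apply Rabs_pos|].
  revert HK; apply filter_imp; intros h Hh.
  apply Rle_trans with (1 := Hh).
  apply Rmult_le_compat_r; [apply pow_le, Cmod_ge_0|apply Rle_abs].
Qed.

Lemma bigO_plus (n : nat) (F G : C -> C) :
  bigO n F -> bigO n G -> bigO n (fun h => F h + G h).
Proof.
  intros [K HK] [L HL]; exists (K + L)%R.
  generalize (filter_and _ _ HK HL); apply filter_imp; intros h [H1 H2].
  generalize (Cmod_triangle (F h) (G h)); lra.
Qed.

Lemma bigO_mult (m n : nat) (F G : C -> C) :
  bigO m F -> bigO n G -> bigO (m + n) (fun h => F h * G h).
Proof.
  intros [K HK] [L HL]; exists (K * L)%R.
  generalize (filter_and _ _ HK HL); apply filter_imp; intros h [H1 H2].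
  rewrite Cmod_mult, pow_add.
  replace (K * L * (Cmod h ^ m * Cmod h ^ n))%R
    with ((K * Cmod h ^ m) * (L * Cmod h ^ n))%R by ring.
  apply Rmult_le_compat; trivial using Cmod_ge_0.
Qed.

Lemma bigO_weaken (m n : nat) (F : C -> C) :
  (m <= n)%nat -> bigO n F -> bigO m F.
Proof.
  intros Hmn HF; destruct (bigO_nonneg _ _ HF) as [K [HK0 HK]]; exists K.
  generalize (filter_and _ _ HK (locally_0_lt 1 Rlt_0_1)).
  apply filter_imp; intros h [H1 H2].
  apply Rle_trans with (1 := H1), Rmult_le_compat_l; trivial.
  replace n with (m + (n - m))%nat by lia.
  rewrite pow_add.
  apply Rle_trans with (Cmod h ^ m * 1)%R; [|right; ring].
  apply Rmult_le_compat_l; [apply pow_le, Cmod_ge_0|].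
  rewrite <- (pow1 (n - m)).
  apply pow_incr; split; [apply Cmod_ge_0|lra].
Qed.

Lemma bigO_const (c : C) : bigO 0 (fun _ => c).
Proof. exists (Cmod c); apply filter_forall; intros h; simpl; lra. Qed.

Lemma bigO_pow (n : nat) : bigO n (fun h => h ^ n).
Proof. exists 1%R; apply filter_forall; intros h; rewrite Cmod_pow; lra. Qed.

Lemma bigO_opp (n : nat) (F : C -> C) : bigO n F -> bigO n (fun h => - F h).
Proof.
  intros [K HK]; exists K; revert HK; apply filter_imp; intros h.
  now rewrite Cmod_opp.
Qed.

Lemma bigO_1_lt (u : C -> C) (d : R) :
  bigO 1 u -> (0 < d)%R -> locally (0 : C) (fun h => (Cmod (u h) < d)%R).
Proof.
  intros Hu Hd; destruct (bigO_nonneg _ _ Hu) as [K [HK0 HK]].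
  assert (He : (0 < d / (K + 1))%R) by (apply Rdiv_lt_0_compat; lra).
  generalize (filter_and _ _ HK (locally_0_lt _ He)).
  apply filter_imp; intros h [H1 H2]; simpl in H1.
  apply Rle_lt_trans with (1 := H1).
  apply Rle_lt_trans with ((K + 1) * Cmod h)%R;
    [generalize (Cmod_ge_0 h); nra|].
  replace d with ((K + 1) * (d / (K + 1)))%R by (field; lra).
  apply Rmult_lt_compat_l; lra.
Qed.

Lemma bigO_1_locally (u : C -> C) (P : C -> Prop) :
  bigO 1 u -> locally (0 : C) P -> locally (0 : C) (fun h => P (u h)).
Proof.
  intros Hu HP; apply locally_Cmod in HP; destruct HP as [d [Hd HP]].
  generalize (bigO_1_lt u d Hu Hd); apply filter_imp; intros h Hh.
  rewrite <- (Cplus_0_l (u h)); auto.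
Qed.

Lemma bigO_comp (n : nat) (F u : C -> C) :
  bigO n F -> bigO 1 u -> bigO n (fun h => F (u h)).
Proof.
  intros HF Hu; destruct (bigO_nonneg _ _ HF) as [K [HK0 HK]].
  destruct Hu as [L HL].
  exists (K * L ^ n)%R.
  generalize (filter_and _ _ (bigO_1_locally u _ (ex_intro _ L HL) HK) HL).
  apply filter_imp; intros h [H1 H2]; simpl in H2.
  rewrite Rmult_1_r in H2.
  apply Rle_trans with (1 := H1).
  rewrite Rmult_assoc, <- Rpow_mult_distr.
  apply Rmult_le_compat_l; trivial.
  apply pow_incr; split; trivial using Cmod_ge_0.
Qed.

Definition jet (F : C -> C) (z0 c0 c1 c2 : C) : Prop :=
  bigO 3 (fun h => F (z0 + h) - (c0 + c1 * h + c2 * h ^ 2)).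

Lemma jet_ext (F G : C -> C) (z0 c0 c1 c2 : C) :
  locally (0 : C) (fun h => F (z0 + h) = G (z0 + h)) ->
  jet F z0 c0 c1 c2 -> jet G z0 c0 c1 c2.
Proof.
  intros H; apply bigO_ext; revert H; apply filter_imp; intros h; simpl.
  now intros ->.
Qed.

Lemma jet_quadratic (z0 c0 c1 c2 : C) :
  jet (fun z => c0 + c1 * (z - z0) + c2 * (z - z0) ^ 2) z0 c0 c1 c2.
Proof.
  exists 0%R; apply filter_forall; intros h.
  replace (_ - _) with (RtoC 0) by ring.
  rewrite Cmod_0; lra.
Qed.

Lemma jet_const (c z0 : C) : jet (fun _ => c) z0 c 0 0.
Proof.
  apply jet_ext with (2 := jet_quadratic z0 c 0 0).
  apply filter_forall; intros h; ring.
Qed.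

Lemma bigO_quadratic (c0 c1 c2 : C) :
  bigO 0 (fun h => c0 + c1 * h + c2 * h ^ 2).
Proof.
  repeat apply bigO_plus.
  - apply bigO_const.
  - apply (bigO_mult 0 0); [apply bigO_const|].
    apply bigO_ext with (fun h => h ^ 1);
      [apply filter_forall; intros; simpl; ring|].
    apply (bigO_weaken 0 1); [lia|apply bigO_pow].
  - apply (bigO_mult 0 0); [apply bigO_const|].
    apply (bigO_weaken 0 2); [lia|apply bigO_pow].
Qed.

Lemma jet_bounded (F : C -> C) (z0 c0 c1 c2 : C) :
  jet F z0 c0 c1 c2 -> bigO 0 (fun h => F (z0 + h)).
Proof.
  intros HF.
  apply bigO_ext with (fun h => (F (z0 + h) - (c0 + c1 * h + c2 * h ^ 2))
                                + (c0 + c1 * h + c2 * h ^ 2));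
    [apply filter_forall; intros; ring|].
  apply bigO_plus; [|apply bigO_quadratic].
  apply (bigO_weaken 0 3); [lia|exact HF].
Qed.

Lemma jet_plus (F G : C -> C) (z0 c0 c1 c2 d0 d1 d2 : C) :
  jet F z0 c0 c1 c2 -> jet G z0 d0 d1 d2 ->
  jet (fun z => F z + G z) z0 (c0 + d0) (c1 + d1) (c2 + d2).
Proof.
  intros HF HG; unfold jet.
  eapply bigO_ext; [|apply (bigO_plus _ _ _ HF HG)].
  apply filter_forall; intros; ring.
Qed.

Lemma jet_mult (F G : C -> C) (z0 c0 c1 c2 d0 d1 d2 : C) :
  jet F z0 c0 c1 c2 -> jet G z0 d0 d1 d2 ->
  jet (fun z => F z * G z) z0
    (c0 * d0) (c0 * d1 + c1 * d0) (c0 * d2 + c1 * d1 + c2 * d0).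
Proof.
  intros HF HG; unfold jet.
  (* For the Taylor polynomials [p] and [q], [F G - p q = (F - p) G + p (G - q)]; the third summand
     is the part of [p q] of degree 3 and 4. *)
  generalize (bigO_mult 3 0 _ _ HF (jet_bounded _ _ _ _ _ HG)).
  generalize (bigO_mult 0 3 _ _ (bigO_quadratic c0 c1 c2) HG).
  generalize (bigO_mult 3 0 _ _ (bigO_pow 3)
                (bigO_quadratic (c1 * d2 + c2 * d1) (c2 * d2) 0)).
  intros H1 H2 H3.
  eapply bigO_ext; [|apply (bigO_plus _ _ _ (bigO_plus _ _ _ H1 H2) H3)].
  apply filter_forall; intros; ring.
Qed.

Lemma jet_scal (k : C) (F : C -> C) (z0 c0 c1 c2 : C) :
  jet F z0 c0 c1 c2 -> jet (fun z => k * F z) z0 (k * c0) (k * c1) (k * c2).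
Proof.
  intros HF; generalize (jet_mult _ _ _ _ _ _ _ _ _ (jet_const k z0) HF).
  now replace (k * c1 + 0 * c0) with (k * c1) by ring;
    replace (k * c2 + 0 * c1 + 0 * c0) with (k * c2) by ring.
Qed.

Lemma bigO_value (n : nat) (F : C -> C) : bigO (S n) F -> F 0 = 0.
Proof.
  intros [K HK]; apply locally_singleton in HK.
  rewrite Cmod_0 in HK; simpl in HK.
  apply Cmod_eq_0; generalize (Cmod_ge_0 (F 0)); lra.
Qed.

Lemma jet_value (F : C -> C) (z0 c0 c1 c2 : C) :
  jet F z0 c0 c1 c2 -> F z0 = c0.
Proof.
  intros HF; apply bigO_value in HF; simpl in HF.
  rewrite Cplus_0_r in HF.
  replace (F z0) with (F z0 - (c0 + c1 * 0 + c2 * (0 * (0 * 1))) + c0) by ring.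
  rewrite HF; ring.
Qed.

Lemma jet_increment (F : C -> C) (z0 c0 c1 c2 : C) :
  jet F z0 c0 c1 c2 -> bigO 1 (fun h => F (z0 + h) - c0).
Proof.
  intros HF.
  generalize (bigO_mult 1 0 _ _ (bigO_pow 1) (bigO_quadratic c1 c2 0)).
  intros H; generalize (bigO_plus _ _ _ (bigO_weaken 1 3 _ ltac:(lia) HF) H).
  apply bigO_ext, filter_forall; intros; ring.
Qed.

Lemma jet_locally_ball (F : C -> C) (z0 c0 c1 c2 : C) (d : R) :
  jet F z0 c0 c1 c2 -> (0 < d)%R ->
  locally (0 : C) (fun h => (Cmod (F (z0 + h)%C - F z0) < d)%R).
Proof.
  intros HF Hd; rewrite (jet_value _ _ _ _ _ HF).
  apply bigO_1_lt with (2 := Hd); apply (jet_increment _ _ _ _ _ HF).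
Qed.

Lemma jet_comp (F u : C -> C) (z0 c0 c1 c2 d0 d1 d2 : C) :
  jet u z0 d0 d1 d2 -> jet F d0 c0 c1 c2 ->
  jet (fun z => F (u z)) z0 c0 (c1 * d1) (c1 * d2 + c2 * d1 ^ 2).
Proof.
  intros Hu HF.
  assert (Hu1 := jet_increment _ _ _ _ _ Hu).
  assert (H1 := bigO_comp _ _ _ HF Hu1); simpl in H1.
  assert (Hs : jet (fun z => u z + - d0) z0 0 d1 d2).
  { generalize (jet_plus _ _ _ _ _ _ _ _ _ Hu (jet_const (- d0) z0)).
    now replace (d0 + - d0) with (RtoC 0) by ring; rewrite !Cplus_0_r. }
  generalize (jet_plus _ _ _ _ _ _ _ _ _ (jet_const c0 z0)
    (jet_plus _ _ _ _ _ _ _ _ _ (jet_scal c1 _ _ _ _ _ Hs)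
       (jet_scal c2 _ _ _ _ _ (jet_mult _ _ _ _ _ _ _ _ _ Hs Hs)))).
  intros H2; generalize (bigO_plus _ _ _ H1 H2).
  apply bigO_ext, filter_forall; intros h.
  replace (d0 + (u (z0 + h) - d0)) with (u (z0 + h)) by ring.
  ring.
Qed.

(** If [q] is the quadratic candidate for [/ G], then [/ G - q = - (q G - 1) / G]. Here [q G - 1] is
    of order 3 by the product rule, and [/ G] is bounded because [G] keeps at least half the modulus
    of [d0]. *)
Lemma jet_inv (G : C -> C) (z0 d0 d1 d2 : C) :
  jet G z0 d0 d1 d2 -> d0 <> 0 ->
  jet (fun z => / G z) z0 (/ d0) (- d1 / d0 ^ 2)
    (d1 ^ 2 / d0 ^ 3 - d2 / d0 ^ 2).
Proof.
  intros HG Hd.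
  assert (Hd' : (0 < Cmod d0 / 2)%R)
    by (generalize (proj1 (Cmod_gt_0 _) Hd); lra).
  assert (Hnear := bigO_1_lt _ _ (jet_increment _ _ _ _ _ HG) Hd').
  assert (Hlow : locally (0 : C)
                   (fun h => (Cmod d0 / 2 <= Cmod (G (z0 + h)%C))%R)).
  { revert Hnear; apply filter_imp; intros h Hh.
    generalize (Cmod_triangle (G (z0 + h)) (- (G (z0 + h) - d0))).
    rewrite Cmod_opp.
    replace (G (z0 + h) + - (G (z0 + h) - d0)) with d0 by ring; lra. }
  assert (Hnz : forall h, (Cmod d0 / 2 <= Cmod (G (z0 + h)%C))%R ->
                          G (z0 + h) <> 0).
  { intros h Hh; apply Cmod_gt_0; lra. }
  assert (Hinv : bigO 0 (fun h => / G (z0 + h))).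
  { exists (2 / Cmod d0)%R; revert Hlow; apply filter_imp; intros h Hh.
    rewrite Cmod_inv by auto; simpl; rewrite Rmult_1_r.
    replace (2 / Cmod d0)%R with (/ (Cmod d0 / 2))%R by (field; lra).
    apply Rinv_le_contravar; trivial. }
  generalize (jet_mult _ _ _ _ _ _ _ _ _
    (jet_quadratic z0 (/ d0) (- d1 / d0 ^ 2)
      (d1 ^ 2 / d0 ^ 3 - d2 / d0 ^ 2)) HG).
  intros H; generalize (bigO_opp _ _ (bigO_mult 3 0 _ _ H Hinv)).
  apply bigO_ext; revert Hlow; apply filter_imp; intros h Hh.
  field; auto.
Qed.

(** Letting [h] run through small positive reals kills the coefficients one after the other. The
    neighbourhood is punctured because the identities compared later arise by dividing by [z]. *)
Lemma quadratic_bigO_3 (c0 c1 c2 : C) :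
  (exists K : R, locally' (0 : C)
    (fun h => (Cmod (c0 + c1 * h + c2 * h ^ 2) <= K * Cmod h ^ 3)%R)) ->
  c0 = 0 /\ c1 = 0 /\ c2 = 0.
Proof.
  intros [K HK]; apply locally_Cmod in HK; destruct HK as [d [Hd HK]].
  assert (Hred : forall (n : nat) (e : C) (L : R),
    (forall t : R, (0 < t < Rmin d 1)%R ->
       (Cmod e * t ^ n <= L * t ^ S n)%R) -> e = 0).
  { intros n e L HL; apply Cmod_eq_0.
    destruct (Cmod_ge_0 e) as [He|He]; [exfalso|now rewrite <- He].
    assert (Hm : (0 < Rmin d 1)%R) by (apply Rmin_pos; lra).
    assert (HL0 := Rabs_pos L).
    pose (t := Rmin (Rmin d 1 / 2) (Cmod e / (2 * (Rabs L + 1)))).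
    assert (Ht1 : (0 < Cmod e / (2 * (Rabs L + 1)))%R)
      by (apply Rdiv_lt_0_compat; lra).
    assert (Ht0 : (0 < t)%R) by (apply Rmin_pos; lra).
    assert (Ht2 : (t <= Rmin d 1 / 2)%R) by apply Rmin_l.
    assert (Ht3 : (t <= Cmod e / (2 * (Rabs L + 1)))%R) by apply Rmin_r.
    assert (H := HL t ltac:(lra)).
    simpl in H; assert (Hp := pow_lt t n Ht0).
    assert (H4 : (Cmod e <= L * t)%R).
    { apply Rmult_le_reg_r with (1 := Hp); lra. }
    assert (H5 : ((Rabs L + 1) * t <= Cmod e / 2)%R).
    { replace (Cmod e / 2)%R
        with ((Rabs L + 1) * (Cmod e / (2 * (Rabs L + 1))))%R by (field; lra).
      apply Rmult_le_compat_l; lra. }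
    generalize (Rle_abs L); nra. }
  assert (Hmain : forall t : R, (0 < t < Rmin d 1)%R ->
    (Cmod (c0 + c1 * t + c2 * t ^ 2) <= K * t ^ 3)%R).
  { intros t [Ht0 Ht1].
    assert (Hc : Cmod t = t) by (rewrite Cmod_R; apply Rabs_pos_eq; lra).
    assert (H : (Cmod (0 + t) < d)%R).
    { rewrite Cplus_0_l, Hc; generalize (Rmin_l d 1); lra. }
    rewrite Cplus_0_l in H; specialize (HK _ H); rewrite Cplus_0_l in HK.
    rewrite Hc in HK; apply HK.
    intros He; apply (f_equal Cmod) in He; rewrite Hc, Cmod_0 in He; lra. }
  assert (Hpos : forall t : R, (0 < t)%R -> Cmod t = t)
    by (intros t Ht; rewrite Cmod_R; apply Rabs_pos_eq; lra).
  assert (H0 : c0 = 0).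
  { apply (Hred 0%nat c0 (Rabs K + Cmod c1 + Cmod c2)%R).
    intros t Ht; generalize (Hmain t Ht).
    generalize (Rmin_r d 1); intros Hr.
    generalize (Cmod_triangle (c0 + c1 * t + c2 * t ^ 2)
                  (- (c1 * t + c2 * t ^ 2))).
    replace (c0 + c1 * t + c2 * t ^ 2 + - (c1 * t + c2 * t ^ 2)) with c0
      by ring.
    rewrite Cmod_opp; intros H1 H2.
    generalize (Cmod_triangle (c1 * t) (c2 * t ^ 2)).
    rewrite !Cmod_mult, Cmod_pow, (Hpos t) by lra; simpl.
    generalize (Cmod_ge_0 c2) (Rle_abs K) (Rabs_pos K); intros.
    assert (K * (t * (t * (t * 1))) <= Rabs K * t)%R.
    { apply Rle_trans with (Rabs K * (t * (t * (t * 1))))%R.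
      apply Rmult_le_compat_r; [|lra].
      repeat apply Rmult_le_pos; lra.
      apply Rmult_le_compat_l; [lra|]. nra. }
    assert (Cmod c2 * (t * (t * 1)) <= Cmod c2 * t)%R
      by (apply Rmult_le_compat_l; nra).
    simpl in *; lra. }
  assert (H1 : c1 = 0).
  { apply (Hred 1%nat c1 (Rabs K + Cmod c2)%R).
    intros t Ht; generalize (Hmain t Ht); rewrite H0.
    generalize (Rmin_r d 1); intros Hr.
    generalize (Cmod_triangle (0 + c1 * t + c2 * t ^ 2)
                  (- (c2 * t ^ 2))).
    replace (0 + c1 * t + c2 * t ^ 2 + - (c2 * t ^ 2)) with (c1 * t)
      by ring.
    rewrite Cmod_opp; intros H1 H2.
    rewrite !Cmod_mult, Cmod_pow, (Hpos t) in H1 by lra; simpl in *.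
    generalize (Cmod_ge_0 c2) (Rle_abs K) (Rabs_pos K); intros.
    assert (K * (t * (t * (t * 1))) <= Rabs K * (t * t))%R.
    { apply Rle_trans with (Rabs K * (t * (t * (t * 1))))%R.
      apply Rmult_le_compat_r; [|lra].
      repeat apply Rmult_le_pos; lra.
      apply Rmult_le_compat_l; [lra|]. nra. }
    nra. }
  repeat split; trivial.
  apply (Hred 2%nat c2 K).
  intros t Ht; generalize (Hmain t Ht); rewrite H0, H1.
  replace (0 + 0 * t + c2 * t ^ 2) with (c2 * t ^ 2) by ring.
  now rewrite Cmod_mult, Cmod_pow, (Hpos t) by lra.
Qed.

Lemma jet_unique (F G : C -> C) (z0 c0 c1 c2 d0 d1 d2 : C) :
  jet F z0 c0 c1 c2 -> jet G z0 d0 d1 d2 ->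
  locally' (0 : C) (fun h => F (z0 + h) = G (z0 + h)) ->
  c0 = d0 /\ c1 = d1 /\ c2 = d2.
Proof.
  intros HF HG Heq.
  destruct (bigO_plus _ _ _ (bigO_opp _ _ HF) HG) as [K HK].
  destruct (quadratic_bigO_3 (c0 - d0) (c1 - d1) (c2 - d2)) as [H0 [H1 H2]].
  { exists K; generalize (filter_and _ _ Heq (filter_le_within (fun h : C => h <> 0) _ HK)).
    apply filter_imp; intros h [He Hh].
    rewrite He in Hh; revert Hh; apply Rle_trans, Req_le, f_equal; ring. }
  assert (Hsub : forall x y : C, x - y = 0 -> x = y).
  { intros x y H; replace x with (x - y + y) by ring; rewrite H; ring. }
  auto.
Qed.

(** * Maximum principle and the Schwarz-Pick inequality *)

(** Without a maximum, each point of the disk has a neighbourhood on which [G] stays below its value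
    at some other disk point. Finitely many neighbourhoods suffice, and a disk point whose value is
    at least all these finitely many values lies in one of them: a contradiction. *)
Lemma usc_attains_max_on_disk (G : C -> R) (r : R) (hr : (0 <= r)%R)
  (hG : forall z : C, (Cmod z <= r)%R -> forall e : R, (0 < e)%R ->
     locally z (fun y => (G y < G z + e)%R)) :
  exists z0 : C, (Cmod z0 <= r)%R /\
    forall z : C, (Cmod z <= r)%R -> (G z <= G z0)%R.
Proof.
  apply NNPP; intros Hno.
  assert (H0 : (Cmod 0 <= r)%R) by now rewrite Cmod_0.
  assert (Hbig : forall z : C, (Cmod z <= r)%R ->
    exists z' : C, (Cmod z' <= r)%R /\ (G z < G z')%R).
  { intros z Hz; apply NNPP; intros Hn; apply Hno; exists z; split; trivial.
    intros y Hy; apply Rnot_lt_le; intros Hlt; apply Hn; now exists y. }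
  assert (Hcov : forall t : C, exists p : C * posreal,
    (Cmod (fst p) <= r)%R /\
    forall y : C, ball t (snd p) y -> (Cmod y <= r)%R -> (G y < G (fst p))%R).
  { intros t; destruct (Rle_dec (Cmod t) r) as [Ht|Ht].
    - destruct (Hbig t Ht) as [t' [Ht' Hlt]].
      destruct (hG t Ht (G t' - G t)%R ltac:(lra)) as [d Hd].
      exists (t', d); split; trivial.
      intros y Hy _; generalize (Hd y Hy); simpl; lra.
    (* The compact set covered below is the square around the disk; a point outside the disk gets a
       ball that misses the disk, with [0] as a dummy witness. *)
    - assert (Hfar : locally t (fun y => ~ (Cmod y <= r)%R)).
      { apply locally_Cmod; exists (Cmod t - r)%R; split; [lra|].
        intros h Hh Hle; generalize (Cmod_triangle (t + h) (- h)).
        rewrite Cmod_opp; replace (t + h + - h) with t by ring; lra. }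
      destruct Hfar as [d Hd].
      exists (RtoC 0, d); split; trivial.
      intros y Hy Hle; elim (Hd y Hy Hle). }
  destruct (choice _ Hcov) as [p Hp]; clear Hcov.
  (* The finite cover comes under a double negation, which the goal [False] absorbs. *)
  apply (compactness_list 2 ((- r)%R, ((- r)%R, tt)) (r, (r, tt))
           (fun t => snd (p (fst t, fst (snd t))))).
  intros [l Hl].
  assert (Hmax : forall l' : list (Compactness.Tn 2 R),
    exists z : C, (Cmod z <= r)%R /\ forall t, In t l' ->
      (G (fst (p (fst t, fst (snd t)))) <= G z)%R).
  { induction l' as [|t l' [z [Hz IH]]].
    - exists (RtoC 0); split; trivial; intros t [].
    - destruct (Rle_dec (G (fst (p (fst t, fst (snd t))))) (G z)) as [Hle|Hgt].
      + exists z; split; trivial; intros t' [<-|Ht']; auto.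
      + exists (fst (p (fst t, fst (snd t)))); split; [apply Hp|].
        intros t' [<-|Ht']; [lra|]; generalize (IH t' Ht'); lra. }
  destruct (Hmax l) as [z [Hz Hzl]].
  destruct z as [x y].
  assert (Hb := Rle_trans _ _ _ (Rmax_Cmod (x, y)) Hz); simpl in Hb.
  assert (Hx := Rle_trans _ _ _ (Rmax_l _ _) Hb).
  assert (Hy := Rle_trans _ _ _ (Rmax_r _ _) Hb).
  apply Rabs_le_between in Hx; apply Rabs_le_between in Hy.
  destruct (Hl (x, (y, tt))) as [t [Ht [_ Hclose]]].
  { simpl; tauto. }
  specialize (Hzl t Ht).
  destruct t as [t1 [t2 []]]; simpl in *.
  destruct (Hp (t1, t2)) as [_ Hpt].
  assert (Hlt : (G (x, y) < G (fst (p (t1, t2))))%R).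
  { apply Hpt; trivial; split; apply Hclose. }
  lra.
Qed.

Definition has_jet (F : C -> C) (z : C) : Prop :=
  exists c0 c1 c2 : C, jet F z c0 c1 c2.

Lemma has_jet_id (z : C) : has_jet (fun y => y) z.
Proof.
  exists z, 1, 0; apply jet_ext with (2 := jet_quadratic z z 1 0).
  apply filter_forall; intros; ring.
Qed.

Lemma has_jet_locally_ball (F : C -> C) (z : C) (d : R) :
  has_jet F z -> (0 < d)%R -> locally z (fun y => (Cmod (F y - F z) < d)%R).
Proof.
  intros [c0 [c1 [c2 HF]]] Hd.
  generalize (jet_locally_ball _ _ _ _ _ _ HF Hd); intros H.
  apply locally_Cmod in H; destruct H as [e [He H]].
  apply locally_Cmod; exists e; split; trivial; intros h Hh.
  specialize (H h Hh); now rewrite Cplus_0_l in H.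
Qed.

(* Averaging over the directions [1], [i], [-1], [-i] kills the harmonic part
   of the second-order expansion of [|F|^2], leaving [|c1|^2]. *)
Lemma quadratic_four_point_sum (c0 c1 c2 : C) (t : R) (P : C -> C)
  (hP : forall h : C, P h = c0 + c1 * h + c2 * h ^ 2) :
  (Cmod (P t) ^ 2 + Cmod (P (- t)%C) ^ 2
   + Cmod (P (Ci * t)%C) ^ 2 + Cmod (P (- (Ci * t))%C) ^ 2
   = 4 * Cmod c0 ^ 2 + 4 * t ^ 2 * Cmod c1 ^ 2 + 4 * t ^ 4 * Cmod c2 ^ 2)%R.
Proof.
  rewrite !hP, !Cmod2_alt; unfold Re, Im; destruct c0, c1, c2; simpl; ring.
Qed.

Lemma four_point_sum (z : C) (t : R) :
  (Cmod (z + t) ^ 2 + Cmod (z + - t) ^ 2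
   + Cmod (z + Ci * t) ^ 2 + Cmod (z + - (Ci * t)) ^ 2
   = 4 * Cmod z ^ 2 + 4 * t ^ 2)%R.
Proof.
  rewrite !Cmod2_alt; destruct z; simpl; ring.
Qed.

(** A discrete Laplacian: with [F] replaced by its quadratic part, the increments over the four
    points at distance [t] add up to at least [4 e t^2], and the replacement costs at most
    [2 M K t^3] per point. For small [t] some increment is therefore positive. *)
Lemma jet_no_local_max (F : C -> C) (z : C) (e : R) :
  has_jet F z -> (0 < e)%R ->
  ~ locally (0 : C) (fun h => (Cmod (F (z + h)%C) ^ 2 + e * Cmod (z + h) ^ 2
                               <= Cmod (F z) ^ 2 + e * Cmod z ^ 2)%R).
Proof.
  intros [c0 [c1 [c2 HF]]] He Hmax.
  rewrite (jet_value _ _ _ _ _ HF) in Hmax.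
  destruct (bigO_nonneg _ _ HF) as [K [HK0 HK]].
  destruct (bigO_nonneg _ _ (bigO_quadratic c0 c1 c2)) as [M [HM0 HM]].
  generalize (filter_and _ _ Hmax (filter_and _ _ HK HM)); clear Hmax HK HM.
  intros H; apply locally_Cmod in H; destruct H as [d [Hd H]].
  pose (P := fun h : C => c0 + c1 * h + c2 * h ^ 2).
  assert (Hpt : forall h : C, (Cmod h < d)%R ->
    (Cmod (P h) ^ 2 - 2 * M * (K * Cmod h ^ 3) + e * Cmod (z + h) ^ 2
     <= Cmod c0 ^ 2 + e * Cmod z ^ 2)%R).
  { intros h Hh; destruct (H h Hh) as [H1 [H2 H3]]; clear H.
    rewrite Cplus_0_l in *; fold (P h) in *; simpl (_ ^ 0)%R in H3.
    generalize (Cmod_triangle (F (z + h)) (- (F (z + h) - P h))).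
    rewrite Cmod_opp.
    replace (F (z + h) + - (F (z + h) - P h)) with (P h) by ring; intros H4.
    generalize (Cmod_ge_0 (P h)) (Cmod_ge_0 (F (z + h)))
      (Cmod_ge_0 (F (z + h) - P h)); intros.
    assert (Hq : (Cmod (P h) ^ 2 - 2 * Cmod (P h) * Cmod (F (z + h)%C - P h)
                  <= Cmod (F (z + h)%C) ^ 2)%R).
    { destruct (Rle_dec (Cmod (F (z + h) - P h)) (Cmod (P h))); nra. }
    assert (Cmod (P h) * Cmod (F (z + h)%C - P h) <= M * (K * Cmod h ^ 3))%R
      by (apply Rmult_le_compat; lra).
    lra. }
  (* The four inequalities will add up to [e <= 2 M K t], whereas this [t] makes [2 M K t] smaller
     than [e / 2]. *)
  pose (t := Rmin (d / 2) (e / (2 * (2 * M * K + 1)))).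
  assert (HMK : (0 <= M * K)%R) by now apply Rmult_le_pos.
  assert (Ht1 : (0 < e / (2 * (2 * M * K + 1)))%R)
    by (apply Rdiv_lt_0_compat; lra).
  assert (Ht0 : (0 < t)%R) by (apply Rmin_pos; lra).
  assert (Ht2 : (t <= d / 2)%R) by apply Rmin_l.
  assert (Ht3 : ((2 * M * K + 1) * t <= e / 2)%R).
  { replace (e / 2)%R
      with ((2 * M * K + 1) * (e / (2 * (2 * M * K + 1))))%R by (field; lra).
    apply Rmult_le_compat_l; [lra|apply Rmin_r]. }
  assert (Hc : Cmod t = t) by (rewrite Cmod_R; apply Rabs_pos_eq; lra).
  assert (Hci : Cmod (Ci * t) = t) by (rewrite Cmod_mult, Cmod_Ci, Hc; ring).
  generalize (Hpt t) (Hpt (- t)) (Hpt (Ci * t)) (Hpt (- (Ci * t))).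
  rewrite !Cmod_opp, Hc, Hci.
  intros H1 H2 H3 H4.
  assert (Hs1 := quadratic_four_point_sum c0 c1 c2 t P (fun h => eq_refl)).
  assert (Hs2 := f_equal (Rmult e) (four_point_sum z t)).
  specialize (H1 ltac:(lra)); specialize (H2 ltac:(lra));
    specialize (H3 ltac:(lra)); specialize (H4 ltac:(lra)).
  assert (Hlow : (0 <= 4 * t ^ 2 * Cmod c1 ^ 2)%R)
    by (generalize (Cmod_ge_0 c1); intros;
        repeat apply Rmult_le_pos; try apply pow_le; lra).
  assert (Hlow2 : (0 <= 4 * t ^ 4 * Cmod c2 ^ 2)%R)
    by (generalize (Cmod_ge_0 c2); intros;
        repeat apply Rmult_le_pos; try apply pow_le; lra).
  assert (Hcon : (e * (t * t) <= (2 * M * K * t) * (t * t))%R) by lra.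
  apply Rmult_le_reg_r in Hcon; nra.
Qed.

(** The perturbed square has a maximum on the closed disk but none inside, so it is attained on the
    circle, where it is at most [M^2 + e r^2]; then [e] tends to 0. *)
Lemma maximum_principle (F : C -> C) (r M : R)
  (hr : (0 <= r)%R) (hM : (0 <= M)%R)
  (hF : forall z : C, (Cmod z <= r)%R -> has_jet F z)
  (hb : forall z : C, Cmod z = r -> (Cmod (F z) <= M)%R) :
  forall z : C, (Cmod z <= r)%R -> (Cmod (F z) <= M)%R.
Proof.
  intros z Hz.
  assert (Hcont : forall (e : R), (0 < e)%R ->
    forall z : C, (Cmod z <= r)%R -> forall e' : R, (0 < e')%R ->
    locally z (fun y => (Cmod (F y) ^ 2 + e * Cmod y ^ 2
                         < Cmod (F z) ^ 2 + e * Cmod z ^ 2 + e')%R)).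
  { clear z Hz; intros e He z Hz e' He'.
    assert (Hsq : forall a b d : R, (0 <= a)%R -> (0 <= b)%R -> (d <= 1)%R ->
      (b <= a + d)%R -> (0 < d)%R ->
      (b ^ 2 <= a ^ 2 + d * (2 * a + 1))%R) by (intros; nra).
    pose (A := (2 * Cmod (F z) + 1)%R); pose (A' := (2 * Cmod z + 1)%R).
    assert (HA := Cmod_ge_0 (F z)); assert (HA' := Cmod_ge_0 z).
    assert (HeA : (0 < e * A')%R) by (apply Rmult_lt_0_compat; unfold A'; lra).
    pose (d := Rmin 1 (e' / (2 * (A + e * A')))).
    assert (Hd : (0 < d)%R).
    { apply Rmin_pos; [lra|]; apply Rdiv_lt_0_compat; unfold A; lra. }
    assert (Hd1 : (d <= 1)%R) by apply Rmin_l.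
    assert (Hd2 : (d * (A + e * A') < e')%R).
    { apply Rle_lt_trans with (e' / (2 * (A + e * A')) * (A + e * A'))%R.
      - apply Rmult_le_compat_r; [unfold A; lra|apply Rmin_r].
      - replace (_ * _)%R with (e' / 2)%R; [lra|].
        field; unfold A; lra. }
    generalize (filter_and _ _ (has_jet_locally_ball _ _ _ (hF z Hz) Hd)
                  (has_jet_locally_ball _ _ _ (has_jet_id z) Hd)).
    apply filter_imp; intros y [H1 H2].
    generalize (Cmod_triangle (F y - F z) (F z)) (Cmod_triangle (y - z) z).
    replace (F y - F z + F z) with (F y) by ring.
    assert (Hyz : (y - z + z = y :> C)) by ring; rewrite Hyz.
    intros H3 H4.
    assert (H5 := Hsq _ (Cmod (F y)) d HA (Cmod_ge_0 _) Hd1 ltac:(lra) Hd).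
    assert (H6 := Hsq _ (Cmod y) d HA' (Cmod_ge_0 _) Hd1 ltac:(lra) Hd).
    fold A in H5; fold A' in H6.
    apply Rmult_le_compat_l with (r := e) in H6; lra. }
  assert (Hall : forall e : R, (0 < e)%R ->
    (Cmod (F z) ^ 2 <= M ^ 2 + e * r ^ 2)%R).
  { intros e He.
    destruct (usc_attains_max_on_disk _ r hr (Hcont e He)) as [z0 [Hz0 Hmax]].
    destruct Hz0 as [Hlt|Heq].
    - exfalso; apply (jet_no_local_max F z0 e (hF z0 ltac:(lra)) He).
      apply filter_imp with (fun h => (Cmod h < r - Cmod z0)%R);
        [|apply locally_0_lt; lra].
      intros h Hh; apply Hmax; generalize (Cmod_triangle z0 h); lra.
    - specialize (Hmax z Hz); specialize (hb z0 Heq).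
      rewrite Heq in Hmax.
      assert (Cmod (F z0) ^ 2 <= M ^ 2)%R
        by (apply pow_incr; split; [apply Cmod_ge_0|trivial]).
      assert (0 <= e * Cmod z ^ 2)%R
        by (apply Rmult_le_pos; [lra|apply pow_le, Cmod_ge_0]).
      lra. }
  apply Rnot_lt_le; intros Hlt.
  assert (Hd : (0 < Cmod (F z) ^ 2 - M ^ 2)%R) by nra.
  assert (Hr2 : (0 <= r ^ 2)%R) by (apply pow_le; trivial).
  specialize (Hall ((Cmod (F z) ^ 2 - M ^ 2) / (2 * (r ^ 2 + 1)))%R
                ltac:(apply Rdiv_lt_0_compat; lra)).
  assert ((Cmod (F z) ^ 2 - M ^ 2) / (2 * (r ^ 2 + 1)) * (r ^ 2 + 1)
          = (Cmod (F z) ^ 2 - M ^ 2) / 2)%R by (field; lra).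
  assert (0 < (Cmod (F z) ^ 2 - M ^ 2) / (2 * (r ^ 2 + 1)))%R
    by (apply Rdiv_lt_0_compat; lra).
  lra.
Qed.

(** On the circle of radius [r < 1] the hypothesis gives [Cmod (w y) <= / r]; the maximum principle
    carries this inside, and [r] tends to 1. Stating it for the factor [w] lets it serve twice: for
    [u / z], and for a Moebius transform of [u / z] divided by [z]. *)
Lemma schwarz_quotient (w : C -> C)
  (hw : forall z : C, in_disk z -> has_jet w z)
  (hb : forall z : C, in_disk z -> (Cmod (z * w z) <= 1)%R) :
  forall z : C, in_disk z -> (Cmod (w z) <= 1)%R.
Proof.
  unfold in_disk in *; intros z Hz.
  apply Rnot_lt_le; intros Hgt.
  (* A radius between [m] and 1 encloses [z] and has [/ r] below [Cmod (w z)]. *)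
  pose (m := Rmax (Cmod z) (/ Cmod (w z))).
  assert (Hinv : (/ Cmod (w z) < 1)%R).
  { rewrite <- Rinv_1; apply Rinv_lt_contravar; lra. }
  assert (Hm1 : (m < 1)%R) by (apply Rmax_lub_lt; trivial).
  assert (Hm2 : (Cmod z <= m)%R) by apply Rmax_l.
  assert (Hm3 : (/ Cmod (w z) <= m)%R) by apply Rmax_r.
  assert (Hm0 : (0 < / Cmod (w z))%R) by (apply Rinv_0_lt_compat; lra).
  pose (r := ((m + 1) / 2)%R).
  assert (Hr : (m < r < 1)%R) by (unfold r; lra).
  assert (H : (Cmod (w z) <= / r)%R).
  { apply (maximum_principle w r (/ r)); try lra.
    - left; apply Rinv_0_lt_compat; lra.
    - intros y Hy; apply hw; lra.
    - intros y Hy; specialize (hb y ltac:(lra)).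
      rewrite Cmod_mult, Hy in hb.
      apply Rmult_le_reg_l with r; [lra|].
      rewrite Rinv_r by lra; trivial. }
  assert (Hlt : (/ r < / / Cmod (w z))%R).
  { apply Rinv_lt_contravar; [apply Rmult_lt_0_compat|]; lra. }
  rewrite Rinv_inv in Hlt; lra.
Qed.

Lemma mobius_bound (a w : C) :
  (Cmod a <= 1)%R -> (Cmod w <= 1)%R ->
  (Cmod (w - a) <= Cmod (1 - Cconj a * w))%R.
Proof.
  intros Ha Hw.
  assert (H : (Cmod (1 - Cconj a * w) ^ 2 - Cmod (w - a) ^ 2
               = (1 - Cmod a ^ 2) * (1 - Cmod w ^ 2))%R).
  { rewrite !Cmod2_alt; destruct a, w; simpl; ring. }
  assert (0 <= (1 - Cmod a ^ 2) * (1 - Cmod w ^ 2))%R.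
  { generalize (Cmod_ge_0 a) (Cmod_ge_0 w); intros.
    apply Rmult_le_pos; nra. }
  generalize (Cmod_ge_0 (w - a)) (Cmod_ge_0 (1 - Cconj a * w)); intros; nra.
Qed.

Lemma has_jet_const (c z : C) : has_jet (fun _ => c) z.
Proof. exists c, 0, 0; apply jet_const. Qed.

Lemma has_jet_plus (F G : C -> C) (z : C) :
  has_jet F z -> has_jet G z -> has_jet (fun y => F y + G y) z.
Proof.
  intros [c0 [c1 [c2 HF]]] [d0 [d1 [d2 HG]]].
  do 3 eexists; apply (jet_plus _ _ _ _ _ _ _ _ _ HF HG).
Qed.

Lemma has_jet_mult (F G : C -> C) (z : C) :
  has_jet F z -> has_jet G z -> has_jet (fun y => F y * G y) z.
Proof.
  intros [c0 [c1 [c2 HF]]] [d0 [d1 [d2 HG]]].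
  do 3 eexists; apply (jet_mult _ _ _ _ _ _ _ _ _ HF HG).
Qed.

Lemma has_jet_inv (G : C -> C) (z : C) :
  has_jet G z -> G z <> 0 -> has_jet (fun y => / G y) z.
Proof.
  intros [d0 [d1 [d2 HG]]] Hz; rewrite (jet_value _ _ _ _ _ HG) in Hz.
  do 3 eexists; apply (jet_inv _ _ _ _ _ HG Hz).
Qed.

Lemma has_jet_ext (F G : C -> C) (z : C) :
  locally z (fun y => F y = G y) -> has_jet F z -> has_jet G z.
Proof.
  intros Heq [c0 [c1 [c2 HF]]]; exists c0, c1, c2.
  revert HF; apply jet_ext.
  apply locally_Cmod in Heq; destruct Heq as [d [Hd Heq]].
  apply locally_Cmod; exists d; split; trivial; intros h Hh.
  rewrite Cplus_0_l; auto.
Qed.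

Definition slope (u : C -> C) (d : C) (z : C) : C :=
  if Ceq_dec z 0 then d else (u z - u 0) / z.

Lemma slope_spec (u : C -> C) (d z : C) : u z = u 0 + z * slope u d z.
Proof.
  unfold slope; destruct (Ceq_dec z 0) as [->|Hz]; [ring|now field].
Qed.

(** Away from 0 this is a quotient of jets. At 0 a division would cost one order of the error, so
    the jet is read off a factor [v], later a shifted power series, that agrees with the slope
    nearby. *)
Lemma has_jet_slope (u v : C -> C) (d z : C) :
  has_jet u z -> has_jet v 0 ->
  locally (0 : C) (fun y => u y = u 0 + y * v y) -> d = v 0 ->
  has_jet (slope u d) z.
Proof.
  intros Hu Hv Huv ->.
  destruct (Ceq_dec z 0) as [->|Hz].
  - apply has_jet_ext with (2 := Hv).
    revert Huv; apply filter_imp; intros y Hy; unfold slope.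
    destruct (Ceq_dec y 0) as [->|Hy0]; trivial.
    rewrite Hy; now field.
  - apply has_jet_ext with (fun y => (u y + - u 0) * / y).
    + apply locally_Cmod; exists (Cmod z); split; [now apply Cmod_gt_0|].
      intros h Hh; unfold slope.
      destruct (Ceq_dec (z + h) 0) as [H|H]; [exfalso|reflexivity].
      replace h with (z + h + - z) in Hh by ring.
      rewrite H, Cplus_0_l, Cmod_opp in Hh; lra.
    + apply has_jet_mult; [apply has_jet_plus; trivial using has_jet_const|].
      apply has_jet_inv; trivial using has_jet_id.
Qed.

(** Here [v1 0] and [v2 0] are the first two Taylor coefficients of [u]. The Schwarz lemma gives
    [|w| <= 1] for [w = u / z]; applied again to the Moebius transform of [w] that vanishes at 0,
    divided by [z], it yields the second bound at the origin. *)
Lemma schwarz_coefficients (u v1 v2 : C -> C)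
  (hu : forall z : C, in_disk z -> has_jet u z)
  (hub : forall z : C, in_disk z -> in_disk (u z)) (hu0 : u 0 = 0)
  (hv1 : has_jet v1 0) (hv2 : has_jet v2 0)
  (huv1 : locally (0 : C) (fun z => u z = z * v1 z))
  (hv12 : locally (0 : C) (fun z => v1 z = v1 0 + z * v2 z)) :
  (Cmod (v1 0) <= 1 /\ Cmod (v2 0) <= 1 - Cmod (v1 0) ^ 2)%R.
Proof.
  pose (a := v1 0); fold a in hv12; fold a.
  pose (w := slope u a).
  assert (Hw0 : w 0 = a).
  { unfold w, slope; destruct (Ceq_dec 0 0) as [_|H]; [reflexivity|now elim H]. }
  assert (Hwu : forall z, u z = z * w z).
  { intros z; rewrite (slope_spec u a z), hu0 at 1; apply Cplus_0_l. }
  assert (Hw : forall z, in_disk z -> has_jet w z).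
  { intros z Hz; apply has_jet_slope with v1; auto.
    revert huv1; apply filter_imp; intros y ->; rewrite hu0; ring. }
  assert (Hw1 : forall z, in_disk z -> (Cmod (w z) <= 1)%R).
  { apply schwarz_quotient; trivial.
    intros z Hz; rewrite <- Hwu; left; apply hub; trivial. }
  assert (Hdisk0 : in_disk 0) by (unfold in_disk; rewrite Cmod_0; lra).
  assert (Ha := Hw1 0 Hdisk0); rewrite Hw0 in Ha.
  split; trivial.
  pose (w2 := slope w (v2 0)).
  assert (Hw2w : forall z, w z = a + z * w2 z).
  { intros z; rewrite <- Hw0; apply slope_spec. }
  assert (Hw2 : forall z, in_disk z -> has_jet w2 z).
  { intros z Hz; apply has_jet_slope with v2; auto.
    generalize (filter_and _ _ huv1 hv12); apply filter_imp.
    intros y [H1 H2]; rewrite Hw0, <- H2.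
    destruct (Ceq_dec y 0) as [->|Hy]; [now rewrite Hw0|].
    rewrite Hwu in H1.
    replace (w y) with (/ y * (y * w y)) by now field.
    rewrite H1; now field. }
  (* Scaling [w] by [s < 1] keeps the Moebius denominator nonzero even where [Cmod (w z) = 1]. *)
  assert (Hs : forall s : R, (0 < s < 1)%R ->
    (s * Cmod (v2 0) <= 1 - s ^ 2 * Cmod a ^ 2)%R).
  { intros s Hs.
    assert (Hcs : Cmod s = s) by (rewrite Cmod_R; apply Rabs_pos_eq; lra).
    pose (den := fun z => 1 - Cconj (s * a) * (s * w z)).
    assert (Hsw : forall z, in_disk z -> (Cmod (s * w z) < 1)%R).
    { intros z Hz; rewrite Cmod_mult, Hcs.
      specialize (Hw1 z Hz); generalize (Cmod_ge_0 (w z)); nra. }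
    assert (Hsa : (Cmod (s * a) < 1)%R) by (rewrite <- Hw0; auto).
    assert (Hden : forall z, in_disk z -> den z <> 0).
    { intros z Hz; apply Cmod_gt_0; unfold den.
      generalize (Cmod_triangle (1 - Cconj (s * a) * (s * w z))
                    (Cconj (s * a) * (s * w z))).
      replace (1 - Cconj (s * a) * (s * w z) + Cconj (s * a) * (s * w z))
        with (RtoC 1) by ring.
      rewrite Cmod_1, (Cmod_mult (Cconj (s * a))), Cmod_conj.
      specialize (Hsw z Hz).
      generalize (Cmod_ge_0 (s * a)) (Cmod_ge_0 (s * w z)); nra. }
    assert (Hq : (Cmod (s * w2 0 * / den 0) <= 1)%R).
    { apply (schwarz_quotient (fun z => s * w2 z * / den z)); trivial.
      - intros z Hz; apply has_jet_mult;
          [apply has_jet_mult; auto using has_jet_const|].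
        apply has_jet_inv; [|auto].
        apply has_jet_ext with (fun z => 1 + (- Cconj (s * a) * s) * w z);
          [apply filter_forall; intros; unfold den; ring|].
        apply has_jet_plus; [apply has_jet_const|].
        apply has_jet_mult; auto using has_jet_const.
      - intros z Hz; specialize (Hden z Hz).
        replace (z * (s * w2 z * / den z)) with ((s * w z - s * a) / den z)
          by (rewrite Hw2w; now field).
        rewrite Cmod_div by trivial.
        apply Rle_div_l; [now apply Cmod_gt_0|]; rewrite Rmult_1_l.
        apply mobius_bound; left; auto. }
    specialize (Hden 0 Hdisk0).
    rewrite !Cmod_mult, Cmod_inv, Hcs in Hq by trivial.
    assert (Hd0 : den 0 = RtoC (1 - s ^ 2 * Cmod a ^ 2)%R).
    { unfold den; rewrite Hw0.
      rewrite RtoC_minus, RtoC_mult, Cmod2_conj, RtoC_pow.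
      rewrite Cmult_conj; replace (Cconj s) with (RtoC s); [simpl; ring|].
      unfold Cconj, RtoC; simpl; now rewrite Ropp_0. }
    assert (Hpos : (0 < 1 - s ^ 2 * Cmod a ^ 2)%R).
    { generalize (Cmod_ge_0 a); intros.
      assert (s ^ 2 < 1)%R by nra.
      assert (0 <= Cmod a ^ 2 <= 1)%R by nra. nra. }
    rewrite Hd0, Cmod_R, Rabs_pos_eq in Hq by lra.
    apply Rmult_le_compat_r with (r := (1 - s ^ 2 * Cmod a ^ 2)%R) in Hq;
      [|lra].
    rewrite Rmult_assoc, Rinv_l in Hq by lra.
    unfold w2, slope in Hq; destruct (Ceq_dec 0 0) as [_|H]; [|now elim H].
    lra. }
  apply Rnot_lt_le; intros Hgt.
  (* This replaces the limit [s -> 1]: since [s^2 <= s], the inequality [Hs] gives [s^2 X <= 1],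
     whereas the midpoint [s] of [/ X] and 1 has [s^2 X = (X + 2 + / X) / 4 > 1], because
     [X + / X > 2]. *)
  pose (X := (Cmod (v2 0) + Cmod a ^ 2)%R).
  assert (HX : (1 < X)%R) by (unfold X; lra).
  assert (HiX : (0 < / X < 1)%R).
  { split; [apply Rinv_0_lt_compat; lra|].
    rewrite <- Rinv_1; apply Rinv_lt_contravar; lra. }
  assert (HXX : (X * / X = 1)%R) by (apply Rinv_r; lra).
  specialize (Hs ((1 + / X) / 2)%R ltac:(lra)).
  set (s := ((1 + / X) / 2)%R) in *.
  assert (Hs1 : (0 < s < 1)%R) by (unfold s; lra).
  assert (Hle : (s ^ 2 * X <= 1)%R).
  { unfold X; generalize (Cmod_ge_0 (v2 0)) (Cmod_ge_0 a); intros.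
    assert (s ^ 2 * Cmod (v2 0) <= s * Cmod (v2 0))%R
      by (apply Rmult_le_compat_r; nra). lra. }
  assert (Heq : (s ^ 2 * X = (X + 2 + / X) / 4)%R).
  { unfold s; field; lra. }
  assert (0 < (X - 1) ^ 2 * / X)%R
    by (apply Rmult_lt_0_compat; [apply pow_lt|]; lra).
  assert ((X - 1) ^ 2 * / X = X - 2 + / X)%R by (field; lra).
  lra.
Qed.

(** * Complex power series *)

Definition is_Cseries (a : nat -> C) (l : C) : Prop :=
  @is_series C_AbsRing C_NormedModule a l.

Lemma is_Cseries_ext (a b : nat -> C) (l : C) :
  (forall n, a n = b n) -> is_Cseries a l -> is_Cseries b l.
Proof. apply (@is_series_ext C_AbsRing C_NormedModule). Qed.

Lemma is_Cseries_plus (a b : nat -> C) (la lb : C) :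
  is_Cseries a la -> is_Cseries b lb ->
  is_Cseries (fun n => a n + b n) (la + lb).
Proof. apply (@is_series_plus C_AbsRing C_NormedModule). Qed.

Lemma is_Cseries_scal (c : C) (a : nat -> C) (l : C) :
  is_Cseries a l -> is_Cseries (fun n => c * a n) (c * l).
Proof. apply (@is_series_scal C_AbsRing C_NormedModule). Qed.

Lemma is_Cseries_decr (a : nat -> C) (l : C) :
  is_Cseries (fun n => a (S n)) l -> is_Cseries a (a 0%nat + l).
Proof.
  intros H; apply (@is_series_decr_1 C_AbsRing C_NormedModule).
  refine (eq_ind l (is_Cseries (fun n => a (S n))) H _ _).
  change (l = a 0%nat + l + - a 0%nat); ring.
Qed.

(** [CSeries] is built from the real series of the components, so a complex limit is identified with
    it by projecting the partial sums through [Re] and [Im]. *)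
Lemma is_Cseries_component (p : C -> R) (a : nat -> C) (l : C)
  (hp : forall x y : C, p (x + y) = (p x + p y)%R)
  (hc : filterlim p (locally l) (locally (p l))) :
  is_Cseries a l -> is_series (fun n => p (a n)) (p l).
Proof.
  intros H; unfold is_Cseries, is_series in *.
  apply filterlim_ext with (fun n => p (sum_n (G := C_AbelianMonoid) a n)).
  - induction x as [|n IH]; [now rewrite !sum_O|].
    rewrite !sum_Sn, <- IH; apply hp.
  - apply filterlim_comp with (1 := H); exact hc.
Qed.

Lemma CSeries_unique (a : nat -> C) (l : C) : is_Cseries a l -> CSeries a = l.
Proof.
  intros H; destruct l as [x y]; unfold CSeries; f_equal.
  - apply is_series_unique, (is_Cseries_component Re) with (3 := H);
      [reflexivity|].
    apply (@continuous_fst R_UniformSpace R_UniformSpace).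
  - apply is_series_unique, (is_Cseries_component Im) with (3 := H);
      [reflexivity|].
    apply (@continuous_snd R_UniformSpace R_UniformSpace).
Qed.

Lemma geometric_sum_bound (a : nat -> C) (A : R) (n : nat) :
  (forall k, (Cmod (a k) <= A * (1 / 2) ^ k)%R) ->
  (Cmod (sum_n (G := C_AbelianMonoid) a n) <= 2 * A - A * (1 / 2) ^ n)%R.
Proof.
  intros Ha; induction n as [|n IH].
  - rewrite sum_O; specialize (Ha 0%nat); simpl in *; lra.
  - rewrite sum_Sn; specialize (Ha (S n)).
    generalize (Cmod_triangle (sum_n (G := C_AbelianMonoid) a n) (a (S n))).
    unfold plus; simpl in *; lra.
Qed.

Lemma is_Cseries_bound (a : nat -> C) (A : R) (l : C) :
  (forall k, (Cmod (a k) <= A * (1 / 2) ^ k)%R) -> is_Cseries a l ->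
  (Cmod l <= 2 * A)%R.
Proof.
  intros Ha Hl.
  assert (HA : (0 <= A)%R).
  { generalize (Ha 0%nat) (Cmod_ge_0 (a 0%nat)); simpl; lra. }
  assert (H := filterlim_comp _ _ _ _ _ _ _ _ Hl
                 (filterlim_norm (V := C_NormedModule) l)).
  apply (is_lim_seq_le
    (fun n => norm (K := C_AbsRing) (V := C_NormedModule)
                (sum_n (G := C_AbelianMonoid) a n))
    (fun _ => 2 * A)%R (Cmod l) (2 * A)%R).
  - intros n; apply Rle_trans with (2 * A - A * (1 / 2) ^ n)%R.
    + apply geometric_sum_bound; trivial.
    + assert (0 <= A * (1 / 2) ^ n)%R
        by (apply Rmult_le_pos; [|apply pow_le]; lra).
      lra.
  - exact H.
  - apply is_lim_seq_const.
Qed.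

Lemma is_Cseries_CSeries (a : nat -> C) (A : R) :
  (forall k, (Cmod (a k) <= A * (1 / 2) ^ k)%R) -> is_Cseries a (CSeries a).
Proof.
  intros Ha.
  destruct (@ex_series_le C_AbsRing C_CompleteNormedModule a
              (fun k => A * (1 / 2) ^ k)%R Ha) as [l Hl].
  - apply (ex_series_scal (K := R_AbsRing) (V := R_NormedModule) A).
    apply ex_series_geom; rewrite Rabs_pos_eq; lra.
  - replace (CSeries a) with l; [exact Hl|].
    symmetry; apply CSeries_unique; exact Hl.
Qed.

Lemma is_Cpseries_is_Cseries (c : nat -> C) (z l : C) :
  is_Cpseries c z l <-> is_Cseries (fun n => c n * z ^ n) l.
Proof.
  assert (Hpow : forall n, pow_n (K := C_Ring) z n = z ^ n).
  { induction n as [|n IH]; [reflexivity|simpl; now rewrite IH]. }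
  split; apply (@is_series_ext C_AbsRing C_NormedModule); intros n;
    rewrite Cmult_comm, <- Hpow; reflexivity.
Qed.

Lemma eventually_bounded (x : nat -> R) (A : R) (N : nat) :
  (forall n, (N <= n)%nat -> (x n <= A)%R) -> exists A', forall n, (x n <= A')%R.
Proof.
  revert A; induction N as [|N IH]; intros A HA.
  - exists A; intros n; apply HA; lia.
  - apply (IH (Rmax A (x N))); intros n Hn.
    destruct (Nat.eq_dec n N) as [->|Hne]; [apply Rmax_r|].
    apply Rle_trans with A; [apply HA; lia|apply Rmax_l].
Qed.

Lemma is_Cseries_terms_bounded (a : nat -> C) (l : C) :
  is_Cseries a l -> exists A, forall n, (Cmod (a n) <= A)%R.
Proof.
  intros H.
  destruct (@Cauchy_ex_series C_AbsRing C_CompleteNormedModule a (ex_intro _ l H)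
              (mkposreal 1 Rlt_0_1)) as [N HN].
  apply (eventually_bounded _ 1%R N); intros n Hn; left.
  specialize (HN n n Hn Hn); rewrite sum_n_n in HN; exact HN.
Qed.

(** Stands for a positive radius of convergence. The explicit bound passes at once to shifts,
    termwise products and formal derivatives, and for [Cmod z <= / (2 * s)] the series is dominated
    by a geometric one of ratio 1/2. *)
Definition geom_bounded (c : nat -> C) : Prop :=
  exists A s : R, (0 < s)%R /\ forall n, (Cmod (c n) <= A * s ^ n)%R.

Lemma locally_geom_bounded (c : nat -> C) (F : C -> C) :
  locally (0 : C) (fun h => is_Cpseries c h (F h)) -> geom_bounded c.
Proof.
  intros H; apply locally_Cmod in H; destruct H as [d [Hd H]].
  assert (Hc : Cmod (d / 2)%R = (d / 2)%R)
    by (rewrite Cmod_R; apply Rabs_pos_eq; lra).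
  specialize (H (d / 2)%R ltac:(lra)); rewrite Cplus_0_l in H.
  apply is_Cpseries_is_Cseries, is_Cseries_terms_bounded in H.
  destruct H as [A HA]; exists A, (/ (d / 2))%R.
  assert (Hp : (0 < / (d / 2))%R) by (apply Rinv_0_lt_compat; lra).
  split; trivial; intros n; specialize (HA n).
  rewrite Cmod_mult, Cmod_pow, Hc in HA.
  rewrite pow_inv.
  apply Rmult_le_reg_r with ((d / 2) ^ n)%R; [apply pow_lt; lra|].
  rewrite Rmult_assoc, Rinv_l, Rmult_1_r; [exact HA|].
  apply pow_nonzero; lra.
Qed.

Definition Psum (c : nat -> C) (z : C) : C := CSeries (fun n => c n * z ^ n).

Lemma geom_bounded_terms (c : nat -> C) (A s : R) (z : C) (hs : (0 < s)%R) :
  (forall n, (Cmod (c n) <= A * s ^ n)%R) -> (Cmod z * s <= 1 / 2)%R ->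
  forall n, (Cmod (c n * z ^ n) <= A * (1 / 2) ^ n)%R.
Proof.
  intros Hc Hz n; rewrite Cmod_mult, Cmod_pow.
  assert (HA : (0 <= A)%R).
  { generalize (Hc 0%nat) (Cmod_ge_0 (c 0%nat)); simpl; lra. }
  apply Rle_trans with (A * s ^ n * Cmod z ^ n)%R.
  - apply Rmult_le_compat_r; [apply pow_le, Cmod_ge_0|trivial].
  - rewrite Rmult_assoc, <- Rpow_mult_distr.
    apply Rmult_le_compat_l; trivial; apply pow_incr; split; [|lra].
    apply Rmult_le_pos; [lra|apply Cmod_ge_0].
Qed.

Lemma Psum_correct (c : nat -> C) :
  geom_bounded c ->
  locally (0 : C) (fun z => is_Cseries (fun n => c n * z ^ n) (Psum c z)).
Proof.
  intros [A [s [Hs Hc]]].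
  assert (Hr : (0 < / (2 * s))%R) by (apply Rinv_0_lt_compat; lra).
  apply filter_imp with (2 := locally_0_lt _ Hr); intros z Hz.
  apply is_Cseries_CSeries with A.
  apply geom_bounded_terms with s; trivial.
  apply Rle_trans with (/ (2 * s) * s)%R; [|right; field; lra].
  apply Rmult_le_compat_r; lra.
Qed.

Lemma Psum_bigO (c : nat -> C) : geom_bounded c -> bigO 0 (Psum c).
Proof.
  intros Hc; assert (Hcor := Psum_correct c Hc).
  destruct Hc as [A [s [Hs Hc]]]; exists (2 * A)%R.
  assert (Hr : (0 < / (2 * s))%R) by (apply Rinv_0_lt_compat; lra).
  generalize (filter_and _ _ Hcor (locally_0_lt _ Hr)); apply filter_imp.
  intros z [H1 H2]; simpl; rewrite Rmult_1_r.
  apply is_Cseries_bound with (2 := H1).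
  apply geom_bounded_terms with s; trivial.
  apply Rle_trans with (/ (2 * s) * s)%R; [|right; field; lra].
  apply Rmult_le_compat_r; lra.
Qed.

Definition shift (c : nat -> C) (n : nat) : C := c (S n).

Lemma geom_bounded_shift (c : nat -> C) :
  geom_bounded c -> geom_bounded (shift c).
Proof.
  intros [A [s [Hs Hc]]]; exists (A * s)%R, s; split; trivial.
  intros n; generalize (Hc (S n)); simpl; unfold shift; lra.
Qed.

Lemma Psum_shift (c : nat -> C) :
  geom_bounded c ->
  locally (0 : C) (fun z => Psum c z = c 0%nat + z * Psum (shift c) z).
Proof.
  intros Hc; generalize (Psum_correct _ (geom_bounded_shift c Hc)).
  apply filter_imp; intros z H; apply CSeries_unique.
  apply is_Cseries_scal with (c := z) in H.
  replace (c 0%nat) with (c 0%nat * z ^ 0) by (simpl; ring).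
  apply (is_Cseries_decr (fun n => c n * z ^ n)).
  apply is_Cseries_ext with (2 := H); intros n; unfold shift; simpl; ring.
Qed.

(** Three shifts write the remainder as [h ^ 3] times a power series, which is bounded near 0. *)
Lemma Psum_jet (c : nat -> C) :
  geom_bounded c -> jet (Psum c) 0 (c 0%nat) (c 1%nat) (c 2%nat).
Proof.
  intros Hc.
  assert (Hc1 := geom_bounded_shift _ Hc).
  assert (Hc2 := geom_bounded_shift _ Hc1).
  assert (Hc3 := geom_bounded_shift _ Hc2).
  apply bigO_ext with (2 := bigO_mult 3 0 _ _ (bigO_pow 3) (Psum_bigO _ Hc3)).
  generalize (filter_and _ _ (Psum_shift _ Hc)
    (filter_and _ _ (Psum_shift _ Hc1) (Psum_shift _ Hc2))).
  apply filter_imp; intros z [H1 [H2 H3]].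
  rewrite Cplus_0_l, H1, H2, H3; unfold shift; ring.
Qed.

(** * Termwise differentiation of power series *)

Definition deriv_coeffs (c : nat -> C) (n : nat) : C := INR (S n) * c (S n).

Lemma INR_S_le_pow2 (n : nat) : (INR (S n) <= 2 ^ n)%R.
Proof.
  induction n as [|n IH]; [simpl; lra|].
  rewrite S_INR; simpl (2 ^ _)%R.
  assert (1 <= INR (S n))%R by (rewrite S_INR; generalize (pos_INR n); lra).
  lra.
Qed.

Lemma geom_bounded_deriv (c : nat -> C) (A s : R) (hs : (0 < s)%R) :
  (forall n, (Cmod (c n) <= A * s ^ n)%R) ->
  forall n, (Cmod (deriv_coeffs c n) <= (A * s) * (2 * s) ^ n)%R.
Proof.
  intros Hc n; unfold deriv_coeffs; rewrite Cmod_mult, Cmod_R.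
  rewrite Rabs_pos_eq by apply pos_INR.
  rewrite Rpow_mult_distr.
  replace (A * s * (2 ^ n * s ^ n))%R with (2 ^ n * (A * s ^ S n))%R
    by (simpl; ring).
  apply Rmult_le_compat; auto using pos_INR, Cmod_ge_0, INR_S_le_pow2.
Qed.

(** The remainder satisfies [e_(n+1) = (z + h) e_n + n h^2 z^(n-1)], and since [n <= 2 ^ n] the
    constant at most doubles. Multiplying by [rho ^ 2] replaces a factor [rho ^ (n - 2)] on the
    right, so that small [n] and [rho = 0] need no exception. *)
Lemma pow_increment_bound (z h : C) (rho : R) (n : nat) :
  (Cmod z <= rho)%R -> (Cmod (z + h) <= rho)%R ->
  (Cmod ((z + h) ^ n - z ^ n - h * (INR n * z ^ pred n)) * rho ^ 2
   <= 2 ^ n * rho ^ n * Cmod h ^ 2)%R.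
Proof.
  intros Hz Hzh.
  assert (Hrho : (0 <= rho)%R) by (generalize (Cmod_ge_0 z); lra).
  assert (Hh2 : (0 <= Cmod h ^ 2)%R) by apply pow_le, Cmod_ge_0.
  induction n as [|n IH].
  - simpl; replace (1 - 1 - h * (0 * 1)) with (RtoC 0) by ring.
    rewrite Cmod_0; generalize (Cmod_ge_0 h); nra.
  - set (e := (z + h) ^ n - z ^ n - h * (INR n * z ^ pred n)) in *.
    assert (Hz' : INR n * (z * z ^ pred n) = INR n * z ^ n).
    { destruct n as [|n]; [simpl; ring|reflexivity]. }
    replace ((z + h) ^ S n - z ^ S n - h * (INR (S n) * z ^ pred (S n)))
      with ((z + h) * e + INR n * h ^ 2 * z ^ pred n).
    2:{ unfold e; rewrite S_INR, RtoC_plus; simpl.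
        transitivity ((z + h) * (z + h) ^ n - z * z ^ n - h * z ^ n
          - h * (INR n * (z * z ^ pred n))).
        ring. rewrite Hz'; ring. }
    assert (Hp : (Cmod (INR n * h ^ 2 * z ^ pred n) * rho ^ 2
                  <= INR n * Cmod h ^ 2 * rho ^ S n)%R).
    { rewrite !Cmod_mult, !Cmod_pow, Cmod_R, Rabs_pos_eq by apply pos_INR.
      destruct n as [|n]; [simpl; lra|].
      rewrite Rmult_assoc; apply Rmult_le_compat_l;
        [apply Rmult_le_pos; auto using pos_INR|].
      replace (rho ^ S (S n))%R with (rho ^ n * rho ^ 2)%R by (simpl; ring).
      apply Rmult_le_compat_r; [now apply pow_le|].
      apply pow_incr; split; trivial using Cmod_ge_0. }
    generalize (Cmod_triangle ((z + h) * e) (INR n * h ^ 2 * z ^ pred n)).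
    intros Ht; apply Rmult_le_compat_r with (r := (rho ^ 2)%R) in Ht;
      [|now apply pow_le].
    apply Rle_trans with (1 := Ht).
    rewrite Rmult_plus_distr_r, (Cmod_mult (z + h)).
    assert (H1 : (Cmod (z + h) * Cmod e * rho ^ 2
                  <= rho * (2 ^ n * rho ^ n * Cmod h ^ 2))%R).
    { rewrite Rmult_assoc; apply Rmult_le_compat; trivial using Cmod_ge_0.
      apply Rmult_le_pos; [apply Cmod_ge_0|now apply pow_le]. }
    assert (Hn : (INR n <= 2 ^ n)%R).
    { generalize (INR_S_le_pow2 n); rewrite S_INR; lra. }
    assert (H2 : (INR n * Cmod h ^ 2 * rho ^ S n
                  <= 2 ^ n * Cmod h ^ 2 * rho ^ S n)%R).
    { apply Rmult_le_compat_r; [now apply pow_le|].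
      apply Rmult_le_compat_r; trivial. }
    simpl in *; lra.
Qed.

(** At [rho = / (4 * s)] the increment bound contributes [/ rho ^ 2 = 16 s^2], and [2 s rho = 1 / 2]
    is the ratio of the majorant, whose sum doubles 16 to 32. The same radius suits the derived
    series, whose coefficients grow like [(2 * s) ^ n]. *)
Lemma Psum_increment (c : nat -> C) (A s : R) (hs : (0 < s)%R)
  (hc : forall n, (Cmod (c n) <= A * s ^ n)%R) (z h : C) :
  (Cmod z <= / (4 * s))%R -> (Cmod (z + h) <= / (4 * s))%R ->
  (Cmod (Psum c (z + h) - Psum c z - h * Psum (deriv_coeffs c) z)
   <= 32 * A * s ^ 2 * Cmod h ^ 2)%R.
Proof.
  intros Hz Hzh.
  assert (Hr : (0 < / (4 * s))%R) by (apply Rinv_0_lt_compat; lra).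
  assert (HA : (0 <= A)%R).
  { generalize (hc 0%nat) (Cmod_ge_0 (c 0%nat)); simpl; lra. }
  assert (Hsmall : forall y : C, (Cmod y <= / (4 * s))%R ->
    (Cmod y * s <= 1 / 2)%R /\ (Cmod y * (2 * s) <= 1 / 2)%R).
  { intros y Hy.
    assert (H : (Cmod y * s <= / (4 * s) * s)%R)
      by (apply Rmult_le_compat_r; lra).
    replace (/ (4 * s) * s)%R with (1 / 4)%R in H by (field; lra); lra. }
  assert (Hconv : forall y, (Cmod y <= / (4 * s))%R ->
    is_Cseries (fun n => c n * y ^ n) (Psum c y)).
  { intros y Hy; apply is_Cseries_CSeries with A.
    apply geom_bounded_terms with s; trivial; now apply Hsmall. }
  assert (Hd : is_Cseries (fun n => deriv_coeffs c n * z ^ n)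
                 (Psum (deriv_coeffs c) z)).
  { apply is_Cseries_CSeries with (A * s)%R.
    apply geom_bounded_terms with (2 * s)%R; [lra| |now apply Hsmall].
    now apply geom_bounded_deriv. }
  (* Reindexed so that the three series combine termwise; the added term at [n = 0] vanishes,
     whatever [pred 0] is. *)
  assert (Hd' : is_Cseries (fun n => c n * (INR n * z ^ pred n))
                  (Psum (deriv_coeffs c) z)).
  { replace (Psum (deriv_coeffs c) z)
      with (c 0%nat * (INR 0 * z ^ pred 0) + Psum (deriv_coeffs c) z)
      by (simpl; ring).
    apply (is_Cseries_decr (fun n => c n * (INR n * z ^ pred n))).
    apply is_Cseries_ext with (2 := Hd); intros n.
    unfold deriv_coeffs; simpl pred; ring. }
  assert (Hall := is_Cseries_plus _ _ _ _ (Hconv _ Hzh)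
    (is_Cseries_plus _ _ _ _ (is_Cseries_scal (- (1)) _ _ (Hconv _ Hz))
       (is_Cseries_scal (- h) _ _ Hd'))).
  replace (Psum c (z + h) - Psum c z - h * Psum (deriv_coeffs c) z)
    with (Psum c (z + h)
          + (- (1) * Psum c z + - h * Psum (deriv_coeffs c) z)) by ring.
  replace (32 * A * s ^ 2 * Cmod h ^ 2)%R
    with (2 * (16 * A * s ^ 2 * Cmod h ^ 2))%R by ring.
  apply is_Cseries_bound with (2 := Hall); intros n.
  replace (c n * (z + h) ^ n
           + (- (1) * (c n * z ^ n) + - h * (c n * (INR n * z ^ pred n))))
    with (c n * ((z + h) ^ n - z ^ n - h * (INR n * z ^ pred n))) by ring.
  rewrite Cmod_mult.
  assert (Hb := pow_increment_bound z h _ n Hz Hzh).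
  set (e := Cmod ((z + h) ^ n - z ^ n - h * (INR n * z ^ pred n))) in *.
  assert (He : (e <= 16 * s ^ 2 * (2 ^ n * (/ (4 * s)) ^ n * Cmod h ^ 2))%R).
  { replace e with (16 * s ^ 2 * (e * (/ (4 * s)) ^ 2))%R by (field; lra).
    apply Rmult_le_compat_l; [generalize (pow2_ge_0 s); lra|exact Hb]. }
  apply Rle_trans with
    (A * s ^ n * (16 * s ^ 2 * (2 ^ n * (/ (4 * s)) ^ n * Cmod h ^ 2)))%R.
  - apply Rmult_le_compat; trivial; unfold e; apply Cmod_ge_0.
  - right; replace (1 / 2)%R with (s * (2 * / (4 * s)))%R by (field; lra).
    rewrite !Rpow_mult_distr; ring.
Qed.

(** The derivative is identified at every point near 0, because its own jet at 0 is needed later.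
    The difference quotient misses [D] by at most [K * Cmod h]. *)
Lemma Psum_C_derive (F : C -> C) (c : nat -> C) :
  geom_bounded c -> locally (0 : C) (fun z => F z = Psum c z) ->
  locally (0 : C) (fun z => C_derive F z = Psum (deriv_coeffs c) z).
Proof.
  intros [A [s [Hs Hc]]] HF.
  apply locally_Cmod in HF; destruct HF as [d [Hd HF]].
  assert (Hr : (0 < / (4 * s))%R) by (apply Rinv_0_lt_compat; lra).
  assert (Hm : (0 < Rmin d (/ (4 * s)))%R) by now apply Rmin_pos.
  apply filter_imp with (2 := locally_0_lt _ Hm); intros z Hz.
  assert (Hin : forall y, (Cmod y < Rmin d (/ (4 * s)))%R ->
    F y = Psum c y /\ (Cmod y <= / (4 * s))%R).
  { intros y Hy; generalize (Rmin_l d (/ (4 * s))) (Rmin_r d (/ (4 * s))).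
    intros; split; [|lra].
    rewrite <- (Cplus_0_l y); apply HF; lra. }
  unfold C_derive; apply is_C_lim_unique.
  intros P HP; apply locally_Cmod in HP; destruct HP as [e [He HP]].
  assert (HA : (0 <= A)%R).
  { generalize (Hc 0%nat) (Cmod_ge_0 (c 0%nat)); simpl; lra. }
  pose (K := (32 * A * s ^ 2)%R).
  assert (HK : (0 <= K)%R).
  { unfold K; apply Rmult_le_pos; [lra|apply pow2_ge_0]. }
  pose (d' := Rmin (Rmin d (/ (4 * s)) - Cmod z) (e / (K + 1))).
  unfold filtermap, locally', within.
  apply locally_Cmod; exists d'; split.
  { apply Rmin_pos; [lra|apply Rdiv_lt_0_compat; lra]. }
  intros h Hh Hne.
  assert (Hh0 : h <> 0) by (intros ->; apply Hne; apply Cplus_0_r).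
  assert (Hhp := proj1 (Cmod_gt_0 h) Hh0).
  assert (Hh1 : (Cmod h < Rmin d (/ (4 * s)) - Cmod z)%R)
    by (apply Rlt_le_trans with (1 := Hh), Rmin_l).
  assert (Hh2 : (Cmod h < e / (K + 1))%R)
    by (apply Rlt_le_trans with (1 := Hh), Rmin_r).
  destruct (Hin z Hz) as [Hz1 Hz2].
  destruct (Hin (z + h)) as [Hzh1 Hzh2].
  { generalize (Cmod_triangle z h); lra. }
  assert (Hinc := Psum_increment c A s Hs Hc z h Hz2 Hzh2).
  fold K in Hinc.
  set (D := Psum (deriv_coeffs c) z) in *.
  replace ((F (z + h) - F z) / (z + h - z))
    with (D + (F (z + h) - F z - h * D) / h)
    by (replace (z + h - z) with h by ring; now field).
  apply HP; rewrite Cmod_div, Hz1, Hzh1 by trivial.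
  apply Rle_lt_trans with (K * Cmod h)%R.
  - apply Rle_div_l; trivial; simpl in Hinc; lra.
  - apply Rle_lt_trans with ((K + 1) * Cmod h)%R; [nra|].
    replace e with ((K + 1) * (e / (K + 1)))%R by (field; lra).
    apply Rmult_lt_compat_l; lra.
Qed.

(** * Coefficients of the class *)

Definition expands_at (F : C -> C) (z0 : C) (c : nat -> C) : Prop :=
  geom_bounded c /\ locally (0 : C) (fun h => F (z0 + h) = Psum c h).

Lemma locally_pseries_expands_at (F : C -> C) (z0 : C) (c : nat -> C) :
  locally (0 : C) (fun h => is_Cpseries c h (F (z0 + h))) -> expands_at F z0 c.
Proof.
  intros H; split; [exact (locally_geom_bounded _ _ H)|].
  revert H; apply filter_imp; intros h Hh; symmetry.
  exact (CSeries_unique _ _ (proj1 (is_Cpseries_is_Cseries _ _ _) Hh)).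
Qed.

Lemma analytic_disk_expands (F : C -> C) (z : C) :
  analytic_disk F -> in_disk z -> exists c, expands_at F z c.
Proof.
  intros HF Hz; destruct (HF z Hz) as [c Hc]; exists c.
  apply locally_pseries_expands_at.
  apply locally_Cmod in Hc; destruct Hc as [d [Hd Hc]].
  apply locally_Cmod; exists d; split; trivial; intros h Hh.
  rewrite Cplus_0_l; specialize (Hc h Hh).
  now replace (z + h - z) with h in Hc by ring.
Qed.

Lemma has_expansion_expands (F : C -> C) (c : nat -> C) :
  has_expansion F c -> expands_at F 0 c.
Proof.
  intros HF; apply locally_pseries_expands_at.
  apply filter_imp with (2 := locally_0_lt 1 Rlt_0_1).
  intros h Hh; rewrite Cplus_0_l; now apply HF.
Qed.

Lemma expands_at_jet (F : C -> C) (z0 : C) (c : nat -> C) :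
  expands_at F z0 c -> jet F z0 (c 0%nat) (c 1%nat) (c 2%nat).
Proof.
  intros [Hc HF]; generalize (Psum_jet c Hc); unfold jet; apply bigO_ext.
  revert HF; apply filter_imp; intros h ->; now rewrite Cplus_0_l.
Qed.

Lemma expands_at_0_factor (F : C -> C) (c : nat -> C) :
  expands_at F 0 c ->
  locally (0 : C) (fun z => F z = c 0%nat + z * Psum (shift c) z).
Proof.
  intros [Hc HF]; generalize (filter_and _ _ HF (Psum_shift c Hc)).
  apply filter_imp; intros z [H1 <-]; now rewrite Cplus_0_l in H1.
Qed.

(** A jet stops at index 2; removing the constant term and dividing by [h] gains index 3. *)
Lemma expands_at_0_unique (F : C -> C) (c d : nat -> C) :
  expands_at F 0 c -> expands_at F 0 d ->
  c 0%nat = d 0%nat /\ c 1%nat = d 1%nat /\ c 2%nat = d 2%nat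
  /\ c 3%nat = d 3%nat.
Proof.
  intros Hc Hd.
  assert (H0 : c 0%nat = d 0%nat).
  { rewrite <- (jet_value _ _ _ _ _ (expands_at_jet _ _ _ Hc)).
    apply (jet_value _ _ _ _ _ (expands_at_jet _ _ _ Hd)). }
  split; trivial.
  apply (jet_unique (Psum (shift c)) (Psum (shift d)) 0).
  - exact (Psum_jet _ (geom_bounded_shift _ (proj1 Hc))).
  - exact (Psum_jet _ (geom_bounded_shift _ (proj1 Hd))).
  - unfold locally', within.
    generalize (filter_and _ _ (expands_at_0_factor _ _ Hc)
                  (expands_at_0_factor _ _ Hd)).
    apply filter_imp; intros h [H1 H2] Hh; rewrite !Cplus_0_l.
    replace (Psum (shift c) h) with ((F h - c 0%nat) / h)
      by (rewrite H1; now field).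
    rewrite H2, H0; now field.
Qed.

(** Near 0 write [f(z) = z p(z)] and [g(w) = w q(w)]. Off the origin [f (g w) = w] becomes
    [q(w) p(g(w)) = 1], whose orders 1 and 2 give the coefficients of index 2 and 3. *)
Lemma inverse_coefficients (f g : C -> C) (a c : nat -> C) :
  expands_at f 0 a -> expands_at g 0 c ->
  a 0%nat = 0 -> a 1%nat = 1 -> c 0%nat = 0 -> c 1%nat = 1 ->
  locally (0 : C) (fun w => f (g w) = w) ->
  c 2%nat = - a 2%nat /\ c 3%nat = 2 * a 2%nat ^ 2 - a 3%nat.
Proof.
  intros Hf Hg Ha0 Ha1 Hc0 Hc1 Hfg.
  assert (Hgj := expands_at_jet _ _ _ Hg); rewrite Hc0, Hc1 in Hgj.
  assert (Hfs := Psum_jet _ (geom_bounded_shift _ (proj1 Hf))).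
  assert (Hgs := Psum_jet _ (geom_bounded_shift _ (proj1 Hg))).
  unfold shift in Hfs at 2 3 4; unfold shift in Hgs at 2 3 4.
  rewrite Ha1 in Hfs; rewrite Hc1 in Hgs.
  assert (Hprod := jet_mult _ _ _ _ _ _ _ _ _ Hgs (jet_comp _ _ _ _ _ _ _ _ _ Hgj Hfs)).
  assert (Hg1 : bigO 1 g).
  { generalize (jet_increment _ _ _ _ _ Hgj); apply bigO_ext.
    apply filter_forall; intros h; rewrite Cplus_0_l; ring. }
  assert (Hf1 := bigO_1_locally g _ Hg1 (expands_at_0_factor _ _ Hf)).
  destruct (jet_unique _ _ _ _ _ _ _ _ _ Hprod (jet_const 1 0))
    as [_ [H1 H2]].
  { unfold locally', within.
    generalize (filter_and _ _ Hfg (filter_and _ _ Hf1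
                  (expands_at_0_factor _ _ Hg))).
    apply filter_imp; intros w [E1 [E2 E3]] Hw; rewrite Cplus_0_l.
    rewrite Ha0, Cplus_0_l, E1 in E2.
    rewrite Hc0, Cplus_0_l in E3.
    replace (Psum (shift c) w) with (g w / w) by (rewrite E3; now field).
    replace (g w / w * Psum (shift a) (g w))
      with (g w * Psum (shift a) (g w) / w) by now field.
    rewrite <- E2; now field. }
  assert (E1 : c 2%nat = - a 2%nat).
  { replace (c 2%nat) with (1 * (a 2%nat * 1) + c 2%nat * 1 - a 2%nat)
      by ring.
    rewrite H1; ring. }
  split; trivial.
  rewrite E1 in H2.
  match type of H2 with ?X = _ =>
    replace (c 3%nat) with (X + 2 * a 2%nat ^ 2 - a 3%nat) by ring end.
  rewrite H2; ring.
Qed.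

(** * The factors [Theta] and the operator on power series *)

Lemma Cmod_Cexp (z : C) : Cmod (Cexp z) = exp (Re z).
Proof.
  assert (Hp := exp_pos (Re z)).
  unfold Cmod, Cexp; cbn [fst snd].
  replace ((exp (Re z) * cos (Im z)) ^ 2 + (exp (Re z) * sin (Im z)) ^ 2)%R
    with (exp (Re z) ^ 2)%R.
  - apply sqrt_pow2; lra.
  - generalize (sin2_cos2 (Im z)); unfold Rsqr; intros H.
    transitivity (exp (Re z) ^ 2 * (sin (Im z) * sin (Im z)
                                    + cos (Im z) * cos (Im z)))%R; [|ring].
    rewrite H; ring.
Qed.

Lemma Theta_pos (mu b : C) (k : nat) : (0 < Theta mu b k)%R.
Proof. unfold Theta, Cpower; rewrite Cmod_Cexp; apply exp_pos. Qed.

Lemma Carg_bound (z : C) : (Rabs (Carg z) <= PI)%R.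
Proof.
  unfold Carg; generalize (acos_bound (Re z / Cmod z)); intros H.
  destruct (Rle_dec 0 (Im z)); [|rewrite Rabs_Ropp];
    rewrite Rabs_pos_eq; lra.
Qed.

(** The logarithm of [Theta mu b n] is [Re mu * ln (Cmod z) - Im mu * Carg z] with
    [z = (1 + b) / (n + b)]. The argument is bounded by [PI], and the crude estimate [ln x <= x]
    makes the rest grow at most linearly in [n]. *)
Lemma Theta_geom_bounded (mu b : C) (hb : forall n : nat, b <> - INR n) :
  geom_bounded (fun n => Theta mu b n).
Proof.
  pose (M := (Rabs (Re mu) * (Rabs (ln (Cmod (1 + b))) + Cmod b)
              + Rabs (Im mu) * PI)%R).
  pose (s := exp (Rabs (Re mu))).
  assert (Hexp : forall x y, (x <= y)%R -> (exp x <= exp y)%R).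
  { intros x y [H| ->]; [left; now apply exp_increasing|right; reflexivity]. }
  assert (Hs : (0 < s)%R) by apply exp_pos.
  assert (Hpow : forall n, (s ^ n = exp (Rabs (Re mu) * INR n))%R).
  { intros n; unfold s; induction n as [|n IH].
    - simpl; now rewrite Rmult_0_r, exp_0.
    - rewrite S_INR, Rmult_plus_distr_l, exp_plus, <- IH, Rmult_1_r.
      simpl; ring. }
  (* From this [N] on, [Cmod (INR n + b) >= 1], so its logarithm is nonnegative; the finitely many
     smaller indices are absorbed in the constant [A]. *)
  destruct (archimed_cor1 (/ (Cmod b + 1))%R) as [N [HN HN0]].
  { apply Rinv_0_lt_compat; generalize (Cmod_ge_0 b); lra. }
  assert (HbN : (Cmod b + 1 < INR N)%R).
  { apply Rinv_lt_cancel; [apply lt_0_INR; lia|exact HN]. }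
  destruct (eventually_bounded (fun n => Theta mu b n / s ^ n)%R (exp M) N)
    as [A HA].
  - intros n Hn; apply Rle_div_l; [now apply pow_lt|].
    rewrite Hpow, <- exp_plus; unfold Theta, Cpower; rewrite Cmod_Cexp.
    apply Hexp.
    assert (HnN : (INR N <= INR n)%R) by now apply le_INR.
    assert (Hlow : (1 <= Cmod (INR n + b))%R).
    { generalize (Cmod_triangle (INR n + b) (- b)); rewrite Cmod_opp.
      replace (INR n + b + - b) with (RtoC (INR n)) by ring.
      rewrite Cmod_R, Rabs_pos_eq by apply pos_INR; lra. }
    assert (Hup : (Cmod (INR n + b) <= INR n + Cmod b)%R).
    { generalize (Cmod_triangle (INR n) b).
      rewrite Cmod_R, Rabs_pos_eq by apply pos_INR; lra. }
    assert (Hln : (0 <= ln (Cmod (INR n + b)) <= INR n + Cmod b)%R).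
    { split.
      - rewrite <- ln_1; apply ln_le; lra.
      - apply Rle_trans with (2 := Hup).
        assert (H := exp_ineq1_le (ln (Cmod (INR n + b)))).
        rewrite exp_ln in H by lra; lra. }
    assert (H1b : (0 < Cmod (1 + b))%R).
    { apply Cmod_gt_0; intros H; apply (hb 1%nat); simpl.
      replace b with (1 + b - 1) by ring; rewrite H; ring. }
    assert (Hz : (Rabs (ln (Cmod ((1 + b) / (INR n + b))))
                  <= Rabs (ln (Cmod (1 + b))) + (INR n + Cmod b))%R).
    { rewrite Cmod_div by (apply Cmod_gt_0; lra).
      rewrite ln_div by lra.
      apply Rle_trans with (1 := Rabs_triang _ _).
      rewrite Rabs_Ropp, (Rabs_pos_eq (ln (Cmod (INR n + b)))); lra. }
    set (z := (1 + b) / (INR n + b)) in *.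
    replace (Re (mu * Clog z))
      with (Re mu * ln (Cmod z) - Im mu * Carg z)%R by reflexivity.
    assert (H1 : (Re mu * ln (Cmod z)
      <= Rabs (Re mu) * (Rabs (ln (Cmod (1 + b))) + (INR n + Cmod b)))%R).
    { apply Rle_trans with (1 := Rle_abs _); rewrite Rabs_mult.
      apply Rmult_le_compat_l; [apply Rabs_pos|trivial]. }
    assert (H2 : (- (Im mu * Carg z) <= Rabs (Im mu) * PI)%R).
    { apply Rle_trans with (1 := Rle_abs _); rewrite Rabs_Ropp, Rabs_mult.
      apply Rmult_le_compat_l; [apply Rabs_pos|apply Carg_bound]. }
    unfold M; lra.
  - exists A, s; split; trivial; intros n.
    rewrite Cmod_R, Rabs_pos_eq by (left; apply Theta_pos).
    apply Rle_div_l; [now apply pow_lt|apply HA].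
Qed.

Lemma geom_bounded_mult (c d : nat -> C) :
  geom_bounded c -> geom_bounded d -> geom_bounded (fun n => c n * d n).
Proof.
  intros [A [s [Hs Hc]]] [A' [s' [Hs' Hd]]]; exists (A * A')%R, (s * s')%R.
  split; [now apply Rmult_lt_0_compat|]; intros n.
  rewrite Cmod_mult, Rpow_mult_distr.
  replace (A * A' * (s ^ n * s' ^ n))%R
    with ((A * s ^ n) * (A' * s' ^ n))%R by ring.
  apply Rmult_le_compat; trivial using Cmod_ge_0.
Qed.

(** [SA_operator] adds a bare [z] to a sum starting at index 2, so entries 0 and 1 are constants
    independent of [Theta] and [a]. *)
Definition SA_coeffs (mu b : C) (a : nat -> C) (n : nat) : C :=
  match n with
  | 0%nat => 0
  | 1%nat => 1
  | _ => Theta mu b n * a n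
  end.

Lemma SA_coeffs_geom_bounded (mu b : C) (hb : forall n : nat, b <> - INR n)
  (a : nat -> C) : geom_bounded a -> geom_bounded (SA_coeffs mu b a).
Proof.
  intros Ha.
  destruct (geom_bounded_mult _ _ (Theta_geom_bounded mu b hb) Ha)
    as [A [s [Hs H]]].
  assert (HA : (0 <= A)%R).
  { generalize (H 0%nat) (Cmod_ge_0 (Theta mu b 0 * a 0%nat)); simpl; lra. }
  (* The added [/ s] covers entry 1, as [1 <= (A + / s) * s]. *)
  exists (A + / s)%R, s; split; trivial.
  assert (Hi := Rinv_0_lt_compat s Hs).
  intros [|[|n]].
  - simpl; rewrite Cmod_0; lra.
  - simpl; rewrite Cmod_1, Rmult_1_r, Rmult_plus_distr_r, Rinv_l by lra.
    assert (0 <= A * s)%R by (apply Rmult_le_pos; lra); lra.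
  - apply Rle_trans with (1 := H (S (S n))).
    apply Rmult_le_compat_r; [apply pow_le|]; lra.
Qed.

Lemma SA_operator_Psum (mu b : C) (hb : forall n : nat, b <> - INR n)
  (a : nat -> C) :
  geom_bounded a ->
  locally (0 : C)
    (fun z => SA_operator mu b a z = Psum (SA_coeffs mu b a) z).
Proof.
  intros Ha; assert (Hd := SA_coeffs_geom_bounded mu b hb a Ha).
  assert (Hd1 := geom_bounded_shift _ Hd).
  assert (Hd2 := geom_bounded_shift _ Hd1).
  generalize (filter_and _ _ (Psum_shift _ Hd)
    (filter_and _ _ (Psum_shift _ Hd1) (Psum_correct _ Hd2))).
  apply filter_imp; intros z [H1 [H2 H3]].
  rewrite H1, H2; unfold shift at 1; simpl SA_coeffs.
  unfold SA_operator.
  replace (0 + z * (1 + z * Psum (shift (shift (SA_coeffs mu b a))) z))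
    with (z + z ^ 2 * Psum (shift (shift (SA_coeffs mu b a))) z) by ring.
  f_equal; apply CSeries_unique.
  apply is_Cseries_ext with (2 := is_Cseries_scal (z ^ 2) _ _ H3).
  intros n; unfold shift; replace (n + 2)%nat with (S (S n)) by lia.
  simpl; ring.
Qed.

(** The equations are orders 1 and 2 of the condition after clearing the denominator and dividing by
    [z], which avoids expanding the quotient itself. *)
Lemma G_condition_coefficients
  (mu b gamma : C) (lambda : R) (hb : forall n : nat, b <> - INR n)
  (hgamma : gamma <> 0) (phi psi : C -> C) (B1 B2 C0 C1 C2 : C)
  (hphi : jet phi 0 1 B1 B2) (hpsi : jet psi 0 C0 C1 C2)
  (a : nat -> C) (ha : geom_bounded a)
  (hG : G_condition mu b gamma lambda phi psi a) :
  exists u1 u2 : C,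
    (Cmod u1 <= 1)%R /\ (Cmod u2 <= 1 - Cmod u1 ^ 2)%R /\
    (1 - lambda) * Theta mu b 2 * a 2%nat = gamma * C0 * B1 * u1 /\
    2 * (1 - lambda) * Theta mu b 3 * a 3%nat
      - (1 - lambda ^ 2) * Theta mu b 2 ^ 2 * a 2%nat ^ 2
    = gamma * (C0 * (B1 * u2 + B2 * u1 ^ 2) + C1 * B1 * u1).
Proof.
  destruct hG as [Hden [u [Hu [Hu0 [Hudisk Heq]]]]].
  set (J := SA_operator mu b a) in *.
  set (d := SA_coeffs mu b a).
  assert (Hd : geom_bounded d) by now apply SA_coeffs_geom_bounded.
  assert (HJ : locally (0 : C) (fun z => J z = Psum d z))
    by now apply SA_operator_Psum.
  assert (HL := Psum_C_derive J d Hd HJ).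
  assert (Hdisk0 : in_disk 0) by (unfold in_disk; rewrite Cmod_0; lra).
  destruct (analytic_disk_expands u 0 Hu Hdisk0) as [c Hc].
  assert (Huj := expands_at_jet _ _ _ Hc).
  assert (Hc0 : c 0%nat = 0)
    by (rewrite <- (jet_value _ _ _ _ _ Huj); exact Hu0).
  rewrite Hc0 in Huj.
  assert (Hcs := geom_bounded_shift _ (proj1 Hc)).
  assert (Hcss := geom_bounded_shift _ Hcs).
  assert (Hv1 := Psum_jet _ Hcs); assert (Hv2 := Psum_jet _ Hcss).
  assert (Hsch := schwarz_coefficients u (Psum (shift c))
                    (Psum (shift (shift c)))).
  rewrite (jet_value _ _ _ _ _ Hv1), (jet_value _ _ _ _ _ Hv2) in Hsch.
  unfold shift in Hsch at 6 7 8.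
  destruct Hsch as [Hu1 Hu2]; trivial.
  { intros z Hz; destruct (analytic_disk_expands u z Hu Hz) as [c' Hc'].
    do 3 eexists; exact (expands_at_jet _ _ _ Hc'). }
  { do 3 eexists; exact Hv1. }
  { do 3 eexists; exact Hv2. }
  { generalize (expands_at_0_factor _ _ Hc); apply filter_imp.
    intros z ->; rewrite Hc0; ring. }
  { exact (Psum_shift _ Hcs). }
  unfold shift in Hu1, Hu2.
  exists (c 1%nat), (c 2%nat); do 2 (split; trivial).
  assert (HLj : jet (C_derive J) 0 1 (2 * d 2%nat) (3 * d 3%nat)).
  { apply jet_ext with (Psum (deriv_coeffs d)).
    - revert HL; apply filter_imp; intros h E; now rewrite Cplus_0_l, E.
    - replace (RtoC 1) with (deriv_coeffs d 0)
        by (unfold deriv_coeffs; simpl; ring).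
      replace (2 * d 2%nat) with (deriv_coeffs d 1)
        by (unfold deriv_coeffs; simpl; f_equal; f_equal; ring).
      replace (3 * d 3%nat) with (deriv_coeffs d 2)
        by (unfold deriv_coeffs; simpl; f_equal; f_equal; ring).
      destruct Hd as [A [s [Hs Hd]]].
      apply Psum_jet; exists (A * s)%R, (2 * s)%R; split; [lra|].
      now apply geom_bounded_deriv. }
  assert (HKj := Psum_jet _ (geom_bounded_shift _ Hd)).
  unfold shift in HKj at 2 3 4; replace (d 1%nat) with (RtoC 1) in HKj
    by reflexivity.
  assert (Hcomp := jet_comp _ _ _ _ _ _ _ _ _ Huj hphi).
  assert (Hleft := jet_plus _ _ _ _ _ _ _ _ _ (jet_const 1 0)
    (jet_mult _ _ _ _ _ _ _ _ _ (jet_scal gamma _ _ _ _ _ hpsi)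
       (jet_plus _ _ _ _ _ _ _ _ _ Hcomp (jet_const (- (1)) 0)))).
  assert (Hright := jet_plus _ _ _ _ _ _ _ _ _
    (jet_scal (1 - lambda) _ _ _ _ _ HKj) (jet_scal lambda _ _ _ _ _ HLj)).
  destruct (jet_unique _ _ _ _ _ _ _ _ _ HLj
              (jet_mult _ _ _ _ _ _ _ _ _ Hleft Hright)) as [_ [E1 E2]].
  { unfold locally', within.
    generalize (filter_and _ _ (locally_0_lt 1 Rlt_0_1)
                  (filter_and _ _ HJ (Psum_shift d Hd))).
    apply filter_imp; intros z [Hz [HJz HK]] Hz0.
    rewrite !Cplus_0_l.
    specialize (Heq z Hz); specialize (Hden z Hz Hz0).
    unfold G_expression in Heq.
    destruct (Ceq_dec z 0) as [?|_]; [contradiction|].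
    rewrite HK in HJz; replace (d 0%nat) with (RtoC 0) in HJz by reflexivity.
    rewrite Cplus_0_l in HJz.
    (* The denominator vanishes at 0, but its factor [den] has value 1 there and a jet; off 0 the
       required nonvanishing gives [den <> 0]. *)
    assert (Hfac : G_denominator lambda J z
      = z * ((1 - lambda) * Psum (shift d) z + lambda * C_derive J z)).
    { unfold G_denominator; rewrite HJz; ring. }
    set (den := (1 - lambda) * Psum (shift d) z + lambda * C_derive J z) in *.
    rewrite Hfac in Heq, Hden.
    assert (Hd0 : den <> 0).
    { intros H; apply Hden; rewrite H; ring. }
    replace (gamma * psi z * (phi (u z) + - (1)))
      with (gamma * (psi z * (phi (u z) - 1))) by ring.
    rewrite <- Heq; clearbody den.
    generalize (C_derive J z); intros L; field; auto. }
  assert (Hd2 : d 2%nat = Theta mu b 2 * a 2%nat) by reflexivity.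
  assert (Hd3 : d 3%nat = Theta mu b 3 * a 3%nat) by reflexivity.
  clearbody d.
  assert (F1 : (1 - lambda) * d 2%nat = gamma * C0 * B1 * c 1%nat).
  { match type of E1 with ?X = ?Y =>
      replace ((1 - lambda) * d 2%nat)
        with (X - Y + gamma * C0 * B1 * c 1%nat) by ring;
      rewrite E1 at 1; ring end. }
  split; [rewrite <- F1, Hd2; ring|].
  (* At order 2, [gamma * C0 * B1 * u1] meets the first-order coefficient [(1 + lambda) * d 2] of
     the denominator; replacing the former by [(1 - lambda) * d 2] through [F1] produces the factor
     [1 - lambda ^ 2]. *)
  match type of E2 with ?X = ?Y =>
    transitivity (X - Y + gamma * (C0 * (B1 * c 2%nat + B2 * c 1%nat ^ 2)
                                   + C1 * B1 * c 1%nat)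
      + (1 + lambda) * d 2%nat
        * (gamma * C0 * B1 * c 1%nat - (1 - lambda) * d 2%nat))
  end.
  - rewrite Hd2, Hd3; ring.
  - rewrite E2 at 1; rewrite F1; ring.
Qed.

(** * Bounds *)

Lemma coefficient_bounds
  (gamma C0 C1 B2 a2 a3 u1 u2 v1 v2 : C) (lambda B1 T2 T3 : R)
  (hgamma : gamma <> 0) (hlambda : (0 <= lambda < 1)%R)
  (hB1 : (0 < B1)%R) (hT2 : (0 < T2)%R) (hT3 : (0 < T3)%R)
  (hu1 : (Cmod u1 <= 1)%R) (hu2 : (Cmod u2 <= 1 - Cmod u1 ^ 2)%R)
  (hv2 : (Cmod v2 <= 1 - Cmod v1 ^ 2)%R)
  (E1 : (1 - lambda) * T2 * a2 = gamma * C0 * B1 * u1)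
  (E2 : 2 * (1 - lambda) * T3 * a3 - (1 - lambda ^ 2) * T2 ^ 2 * a2 ^ 2
        = gamma * (C0 * (B1 * u2 + B2 * u1 ^ 2) + C1 * B1 * u1))
  (E3 : (1 - lambda) * T2 * - a2 = gamma * C0 * B1 * v1)
  (E4 : 2 * (1 - lambda) * T3 * (2 * a2 ^ 2 - a3)
        - (1 - lambda ^ 2) * T2 ^ 2 * (- a2) ^ 2
        = gamma * (C0 * (B1 * v2 + B2 * v1 ^ 2) + C1 * B1 * v1)) :
  let D :=
    (gamma * C0 * (lambda ^ 2 - 1) * B1 ^ 2 + (1 - lambda) ^ 2 * (B1 - B2))
      * T2 ^ 2
    + 2 * gamma * (1 - lambda) * C0 * B1 ^ 2 * T3 in
  (D <> 0 ->
   (Cmod a2 <= Cmod gamma * Cmod C0 * B1 * sqrt B1 / sqrt (Cmod D))%R)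
  /\
  (Cmod a3 <=
     Cmod gamma * Cmod C1 * B1 / (2 * (1 - lambda) * T3)
     + Cmod gamma * Cmod C0 * B1 / (2 * (1 - lambda) * T3)
     + Cmod gamma ^ 2 * Cmod C0 ^ 2 * B1 ^ 2 / ((1 - lambda) ^ 2 * T2 ^ 2))%R.
Proof.
  intros D.
  assert (Hg := Cmod_ge_0 gamma); assert (HC0 := Cmod_ge_0 C0);
    assert (HC1 := Cmod_ge_0 C1); assert (Hu1 := Cmod_ge_0 u1).
  assert (HR : forall x : R, (0 < x)%R -> Cmod x = x)
    by (intros x Hx; rewrite Cmod_R; apply Rabs_pos_eq; lra).
  assert (Hl : (0 < 1 - lambda)%R) by lra.
  assert (Hm3 : (0 < 2 * (1 - lambda) * T3)%R)
    by (repeat apply Rmult_lt_0_compat; lra).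
  assert (Hm2 : (0 < (1 - lambda) * T2)%R)
    by (apply Rmult_lt_0_compat; lra).
  assert (Ha2 : ((1 - lambda) * T2 * Cmod a2
                 = Cmod gamma * Cmod C0 * B1 * Cmod u1)%R).
  { apply (f_equal Cmod) in E1.
    rewrite <- RtoC_minus, !Cmod_mult in E1.
    now rewrite !HR in E1 by trivial. }
  assert (Hsq1 : (Cmod a2 ^ 2 * ((1 - lambda) ^ 2 * T2 ^ 2)
                 <= Cmod gamma ^ 2 * Cmod C0 ^ 2 * B1 ^ 2)%R).
  { replace (Cmod a2 ^ 2 * ((1 - lambda) ^ 2 * T2 ^ 2))%R
      with (((1 - lambda) * T2 * Cmod a2) ^ 2)%R by ring.
    rewrite Ha2, !Rpow_mult_distr.
    rewrite <- (Rmult_1_r (Cmod gamma ^ 2 * Cmod C0 ^ 2 * B1 ^ 2)) at 2.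
    apply Rmult_le_compat_l.
    - rewrite <- !Rpow_mult_distr; apply pow2_ge_0.
    - rewrite <- (pow1 2); apply pow_incr; lra. }
  assert (Hm22 : (0 < (1 - lambda) ^ 2 * T2 ^ 2)%R)
    by (apply Rmult_lt_0_compat; apply pow_lt; lra).
  apply Rle_div_r in Hsq1; [|exact Hm22].
  assert (HX : (0 <= Cmod gamma * Cmod C0 * B1)%R)
    by (repeat apply Rmult_le_pos; lra).
  assert (HY : (0 <= Cmod gamma * Cmod C1 * B1)%R)
    by (repeat apply Rmult_le_pos; lra).
  assert (HsB := sqrt_pos B1).
  (* With [C0 = 0] the first-order equations no longer relate [u1] and [v1]; but then [a2 = 0], and
     [E2] alone bounds [a3] by its [C1] term. *)
  destruct (Ceq_dec C0 0) as [HC00|HC00].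
  { assert (Ha20 : a2 = 0).
    { apply Cmod_eq_0; rewrite HC00, Cmod_0 in Ha2; nra. }
    split.
    - intros HD; rewrite Ha20, Cmod_0, HC00, Cmod_0; right.
      unfold Rdiv; ring.
    - rewrite HC00, Ha20 in E2.
      assert (H : ((2 * (1 - lambda) * T3)%R * a3 = gamma * C1 * B1 * u1)).
      { rewrite !RtoC_mult, RtoC_minus.
        transitivity (2 * (1 - lambda) * T3 * a3
                      - (1 - lambda ^ 2) * T2 ^ 2 * 0 ^ 2); [simpl; ring|].
        rewrite E2; ring. }
      apply (f_equal Cmod) in H; rewrite !Cmod_mult, !HR in H by trivial.
      assert (H3 : (Cmod a3 <= Cmod gamma * Cmod C1 * B1
                               / (2 * (1 - lambda) * T3))%R).
      { apply Rle_div_r; [exact Hm3|]; rewrite Rmult_comm, H.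
        rewrite <- (Rmult_1_r (Cmod gamma * Cmod C1 * B1)) at 2.
        now apply Rmult_le_compat_l. }
      assert (0 <= Cmod gamma * Cmod C0 * B1 / (2 * (1 - lambda) * T3))%R
        by (apply Rle_div_r; lra).
      generalize (pow2_ge_0 (Cmod a2)); lra. }
  assert (HB1nz : RtoC B1 <> 0) by (apply Cmod_gt_0; rewrite HR; trivial).
  assert (Hv1 : v1 = - u1).
  { assert (H : gamma * C0 * B1 * (v1 + u1) = 0).
    { rewrite Cmult_plus_distr_l, <- E1, <- E3; ring. }
    replace v1 with (/ (gamma * C0 * B1) * (gamma * C0 * B1 * (v1 + u1)) - u1)
      by (field; auto).
    rewrite H; ring. }
  assert (Hcv1 : Cmod v1 = Cmod u1) by (rewrite Hv1; apply Cmod_opp).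
  rewrite Hcv1 in hv2; rewrite Hv1 in E4.
  split.
  - intros HD.
    assert (HDp : (0 < Cmod D)%R) by now apply Cmod_gt_0.
    (* [E2 + E4] eliminates [a3]. It is multiplied by [gamma C0 B1^2], and [2 (B1 - B2)] times the
       square of [E1] is added. *)
    assert (HDa : 2 * (D * a2 ^ 2)
      = gamma ^ 2 * C0 ^ 2 * B1 ^ 3 * (u2 + v2 + 2 * u1 ^ 2)).
    { transitivity (gamma * C0 * B1 ^ 2
          * ((2 * (1 - lambda) * T3 * a3 - (1 - lambda ^ 2) * T2 ^ 2 * a2 ^ 2)
             + (2 * (1 - lambda) * T3 * (2 * a2 ^ 2 - a3)
                - (1 - lambda ^ 2) * T2 ^ 2 * (- a2) ^ 2))
        + 2 * (B1 - B2) * ((1 - lambda) * T2 * a2) ^ 2).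
      - unfold D; ring.
      - rewrite E2, E4, E1; ring. }
    apply (f_equal Cmod) in HDa.
    rewrite !Cmod_mult, !Cmod_pow, !HR in HDa by lra.
    assert (Hsum : (Cmod (u2 + v2 + 2 * u1 ^ 2) <= 2)%R).
    { generalize (Cmod_triangle (u2 + v2) (2 * u1 ^ 2)) (Cmod_triangle u2 v2).
      rewrite Cmod_mult, Cmod_pow, (HR 2%R) by lra; lra. }
    assert (HX2 : (0 <= Cmod gamma ^ 2 * Cmod C0 ^ 2 * B1 ^ 3)%R).
    { apply Rmult_le_pos; [|apply pow_le; lra].
      rewrite <- Rpow_mult_distr; apply pow2_ge_0. }
    assert (Hb : (Cmod a2 ^ 2 * Cmod D
                  <= Cmod gamma ^ 2 * Cmod C0 ^ 2 * B1 ^ 3)%R) by nra.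
    assert (HsD := sqrt_lt_R0 _ HDp).
    apply Rle_div_r; [exact HsD|].
    apply Rsqr_incr_0_var; [|now apply Rmult_le_pos].
    unfold Rsqr.
    replace (Cmod a2 * sqrt (Cmod D) * (Cmod a2 * sqrt (Cmod D)))%R
      with (Cmod a2 ^ 2 * (sqrt (Cmod D) * sqrt (Cmod D)))%R by ring.
    rewrite sqrt_sqrt by lra.
    apply Rle_trans with (1 := Hb); right.
    transitivity (Cmod gamma ^ 2 * Cmod C0 ^ 2 * B1 ^ 2
                  * (sqrt B1 * sqrt B1))%R; [|ring].
    rewrite sqrt_sqrt by lra; ring.
  (* In [E2 - E4], as [v1 = - u1], the [B2] terms cancel and the [C1] terms double. This isolates
     [a3 - a2^2]; the square [a2^2] is then bounded through [E1]. *)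
  - assert (H : 2 * ((2 * (1 - lambda) * T3)%R * (a3 + - a2 ^ 2))
      = gamma * C0 * B1 * (u2 + - v2) + 2 * (gamma * C1 * B1 * u1)).
    { rewrite !RtoC_mult, RtoC_minus.
      transitivity
        ((2 * (1 - lambda) * T3 * a3 - (1 - lambda ^ 2) * T2 ^ 2 * a2 ^ 2)
         - (2 * (1 - lambda) * T3 * (2 * a2 ^ 2 - a3)
            - (1 - lambda ^ 2) * T2 ^ 2 * (- a2) ^ 2)).
      - ring.
      - rewrite E2, E4; ring. }
    apply (f_equal Cmod) in H; rewrite !(Cmod_mult 2), (Cmod_mult (_ * _)%R) in H.
    rewrite !HR in H by lra.
    assert (H1 : (Cmod (gamma * C0 * B1 * (u2 + - v2))
                  <= Cmod gamma * Cmod C0 * B1 * 2)%R).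
    { rewrite !Cmod_mult, (HR B1) by trivial; apply Rmult_le_compat_l; trivial.
      generalize (Cmod_triangle u2 (- v2)); rewrite Cmod_opp.
      generalize (pow2_ge_0 (Cmod u1)); lra. }
    assert (H2 : (Cmod (gamma * C1 * B1 * u1)
                  <= Cmod gamma * Cmod C1 * B1 * 1)%R).
    { rewrite !Cmod_mult, (HR B1) by trivial; now apply Rmult_le_compat_l. }
    assert (H3 := Cmod_triangle (gamma * C0 * B1 * (u2 + - v2))
                    (2 * (gamma * C1 * B1 * u1))).
    rewrite (Cmod_mult 2), (HR 2%R) in H3 by lra.
    assert (H4 : (Cmod (a3 + - a2 ^ 2)
      <= (Cmod gamma * Cmod C1 * B1 + Cmod gamma * Cmod C0 * B1)
         / (2 * (1 - lambda) * T3))%R).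
    { apply Rle_div_r; [exact Hm3|]; lra. }
    rewrite Rdiv_plus_distr in H4.
    generalize (Cmod_triangle (a3 + - a2 ^ 2) (a2 ^ 2)).
    replace (a3 + - a2 ^ 2 + a2 ^ 2) with a3 by ring.
    rewrite Cmod_pow; lra.
Qed.

(** When [D = 0] the bound on [a 2] has denominator 0 and is read as carrying no information; since
    division is total, this reading is expressed by the premise [D <> 0]. *)
Theorem theorem4p1
  (mu b gamma : C) (lambda : R)
  (hb : forall n : nat, b <> - INR n)
  (hgamma : gamma <> 0)
  (hlambda : (0 <= lambda < 1)%R)
  (phi : C -> C) (B : nat -> C) (B1 : R)
  (hphi : analytic_disk phi) (hphiB : has_expansion phi B)
  (hB0 : B 0%nat = 1) (hB1 : B 1%nat = B1) (hB1pos : (0 < B1)%R)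
  (psi : C -> C) (C_ : nat -> C)
  (hpsi : analytic_disk psi) (hpsiC : has_expansion psi C_)
  (hpsi1 : forall z : C, in_disk z -> (Cmod (psi z) < 1)%R)
  (f : C -> C) (a : nat -> C)
  (hfa : classA f a)
  (hf : classG mu b gamma lambda phi psi f) :
  let C0 := C_ 0%nat in
  let C1 := C_ 1%nat in
  let B2 := B 2%nat in
  let Theta2 := Theta mu b 2 in
  let Theta3 := Theta mu b 3 in
  let D :=
    (gamma * C0 * (lambda ^ 2 - 1) * B1 ^ 2 + (1 - lambda) ^ 2 * (B1 - B2))
      * Theta2 ^ 2
    + 2 * gamma * (1 - lambda) * C0 * B1 ^ 2 * Theta3 in
  (D <> 0 ->
   (Cmod (a 2%nat) <=
      Cmod gamma * Cmod C0 * B1 * sqrt B1 / sqrt (Cmod D))%R)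
  /\
  (Cmod (a 3%nat) <=
     Cmod gamma * Cmod C1 * B1 / (2 * (1 - lambda) * Theta3)
     + Cmod gamma * Cmod C0 * B1 / (2 * (1 - lambda) * Theta3)
     + Cmod gamma ^ 2 * Cmod C0 ^ 2 * B1 ^ 2
         / ((1 - lambda) ^ 2 * Theta2 ^ 2))%R.
Proof.
  destruct hf as [_ [g [a' [c [[_ Hinv] [Hfa' [Hgc [Gf Gg]]]]]]]].
  destruct hfa as [_ [Hfa [Ha0 Ha1]]].
  destruct Hfa' as [_ [Hfa' _]].
  destruct Hgc as [_ [Hgc [Hc0 Hc1]]].
  apply has_expansion_expands in Hfa, Hfa', Hgc.
  (* The class supplies its own coefficient sequence [a'] of [f]; uniqueness transfers its equations
     to [a]. *)
  destruct (expands_at_0_unique _ _ _ Hfa Hfa') as [_ [_ [Ea2 Ea3]]].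
  destruct (inverse_coefficients f g a c Hfa Hgc Ha0 Ha1 Hc0 Hc1) as [Ec2 Ec3].
  { revert Hinv; apply filter_imp; tauto. }
  assert (Hphi := expands_at_jet _ _ _ (has_expansion_expands _ _ hphiB)).
  assert (Hpsi := expands_at_jet _ _ _ (has_expansion_expands _ _ hpsiC)).
  rewrite hB0, hB1 in Hphi.
  destruct (G_condition_coefficients mu b gamma lambda hb hgamma phi psi
              _ _ _ _ _ Hphi Hpsi a' (proj1 Hfa') Gf)
    as [u1 [u2 [Hu1 [Hu2 [E1 E2]]]]].
  destruct (G_condition_coefficients mu b gamma lambda hb hgamma phi psi
              _ _ _ _ _ Hphi Hpsi c (proj1 Hgc) Gg)
    as [v1 [v2 [_ [Hv2 [E3 E4]]]]].
  rewrite <- Ea2 in E1, E2; rewrite <- Ea3 in E2.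
  rewrite Ec2 in E3, E4; rewrite Ec3 in E4.
  exact (coefficient_bounds _ _ _ _ _ _ _ _ _ _ _ _ _ _ hgamma hlambda hB1pos
           (Theta_pos mu b 2) (Theta_pos mu b 3) Hu1 Hu2 Hv2 E1 E2 E3 E4).
Qed.
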